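(* The quantity $\eta+\tau_\phi$ is an invariant of framed knots; that is, $\eta(\gamma)+\tau_\phi(\gamma,n)$ is unchanged under isotopy of the framed knot $(\gamma,n)$.
   Context: A knot is a smooth embedding $\gamma:S^1\to\mathbb{R}^3$ with nowhere vanishing derivative (a closed space curve), and $\dot\gamma$ denotes its unit tangent vector. A framing of $\gamma$ is a smooth choice of unit normal vector $n(t)$ at each point of the curve; a framed knot is a pair $(\gamma,n)$. Let $\omega$ be the standard volume (area) form on the unit sphere $S^2$ (total area $4\pi$). Let $C_2(S^1)=\{(x,y)\in S^1\times S^1: x\neq y\}$, and let $\Phi:C_2(S^1)\to S^2$ be the Gauss map, assigning to $(x,y)$ the unit vector from $\gamma(x)$ to $\gamma(y)$. Define $$\eta(\gamma)=\frac{1}{4\pi}\int_{C_2(S^1)}\Phi^*\omega .$$ For the correction term, consider the space of pairs $\mathbb{L}^{\overrightarrow{n}}(S^1)=\{(t,t+\varepsilon\cdot n(t)) : t \text{ a point of the closed space curve},\ 0<\varepsilon\in\mathbb{R}\}$, made up of points of the curve together with points of its pushed-off copies $\gamma_\varepsilon$ in the direction of the framing. Compactify it by pasting on, at $\varepsilon=0$, a new boundary piece $\mathbb{L}^{\overrightarrow{n}}_0(S^1)$ that records directions of approach. This piece consists of pairs $(x,\theta)$, where $x$ is a point of the knot and $\theta$ is the direction from which the point $x$ of $\gamma_\varepsilon$ comes in. For each $x$, the directions $\theta$ form a semicircle whose two endpoints correspond to the backward tangent $-\dot\gamma(x)$ and the forward tangent $\dot\gamma(x)$ and whose apex corresponds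 to the normal $n(x)$ (the path on $S^2$ can be taken to be the half great circle from $-\dot\gamma(x)$ through $n(x)$ to $\dot\gamma(x)$). Thus $\mathbb{L}^{\overrightarrow{n}}_0(S^1)$ is a cylinder, and the Gauss map extends to it as the map $\overline{\Phi_\gamma}$ sending $(x,\theta)$ to the direction $\theta\in S^2$. Define $$\tau_\phi(\gamma,n)=\frac{1}{2\pi}\int_{\mathbb{L}^{\overrightarrow{n}}_0(S^1)}\overline{\Phi_\gamma}^{\,*}\omega .$$
   Formalization: The correction term τ_φ is normalised by 1/(4π) instead of the printed 1/(2π); with 1/(2π) the sum is writhe plus twice the twist, which is not constant under isotopy (e.g. from a round circle to a lifted figure-eight unknot). *)

(* Defs.v *)
From Stdlib Require Import Reals.
From Coquelicot Require Import Coquelicot.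
Open Scope R_scope.

Record vec3 : Type := Vec3 { c1 : R; c2 : R; c3 : R }.

Definition vadd (v w : vec3) : vec3 :=
  Vec3 (c1 v + c1 w) (c2 v + c2 w) (c3 v + c3 w).
Definition vsub (v w : vec3) : vec3 :=
  Vec3 (c1 v - c1 w) (c2 v - c2 w) (c3 v - c3 w).
Definition vscale (a : R) (v : vec3) : vec3 :=
  Vec3 (a * c1 v) (a * c2 v) (a * c3 v).
Definition dot (v w : vec3) : R :=
  c1 v * c1 w + c2 v * c2 w + c3 v * c3 w.
Definition norm3 (v : vec3) : R := sqrt (dot v v).
Definition normalize (v : vec3) : vec3 := vscale (/ norm3 v) v.
Definition det3 (u v w : vec3) : R :=
  c1 u * (c2 v * c3 w - c3 v * c2 w)
  - c2 u * (c1 v * c3 w - c3 v * c1 w)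
  + c3 u * (c1 v * c2 w - c2 v * c1 w).

Definition vDerive (f : R -> vec3) (t : R) : vec3 :=
  Vec3 (Derive (fun s => c1 (f s)) t)
       (Derive (fun s => c2 (f s)) t)
       (Derive (fun s => c3 (f s)) t).

Definition smooth (f : R -> R) : Prop :=
  forall (k : nat) (t : R), ex_derive_n f k t.
Definition smooth2 (f : R -> R -> R) : Prop :=
  forall (k : nat) (u t : R), ex_diff_n f k u t.

Definition vsmooth (f : R -> vec3) : Prop :=
  smooth (fun t => c1 (f t)) /\
  smooth (fun t => c2 (f t)) /\
  smooth (fun t => c3 (f t)).
Definition vsmooth2 (f : R -> R -> vec3) : Prop :=
  smooth2 (fun u t => c1 (f u t)) /\
  smooth2 (fun u t => c2 (f u t)) /\
  smooth2 (fun u t => c3 (f u t)).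

(* The circle S^1 is R/Z: a map on S^1 is a map on R of period 1. *)
Definition on_circle (f : R -> vec3) : Prop := forall t, f (t + 1) = f t.

Definition tangent (g : R -> vec3) (t : R) : vec3 := normalize (vDerive g t).

Definition knot (g : R -> vec3) : Prop :=
  on_circle g /\
  vsmooth g /\
  (forall s t, g s = g t -> exists k : Z, s - t = IZR k) /\
  (forall t, vDerive g t <> Vec3 0 0 0).

Definition framing (g n : R -> vec3) : Prop :=
  on_circle n /\
  vsmooth n /\
  (forall t, norm3 (n t) = 1) /\
  (forall t, dot (n t) (tangent g t) = 0).

Definition framed_knot (g n : R -> vec3) : Prop := knot g /\ framing g n.

(* Isotopy through framed knots, parametrised by u in [0,1].  As usual, a map
   is smooth on the closed set [0,1] x S^1 if it is the restriction of a smooth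
   map; nothing but smoothness is required of the extension for u outside
   [0,1]. *)
Definition framed_isotopic (g0 n0 g1 n1 : R -> vec3) : Prop :=
  exists G N : R -> R -> vec3,
    vsmooth2 G /\ vsmooth2 N /\
    (forall u, 0 <= u <= 1 -> framed_knot (G u) (N u)) /\
    (forall t, G 0 t = g0 t) /\ (forall t, N 0 t = n0 t) /\
    (forall t, G 1 t = g1 t) /\ (forall t, N 1 t = n1 t).

(* The area form of the unit sphere is omega_p(v,w) = det(p,v,w), so for F with
   values in S^2, F^*omega = pullback_area F x y dx /\ dy. *)
Definition pullback_area (F : R -> R -> vec3) (x y : R) : R :=
  det3 (F x y) (vDerive (fun s => F s y) x) (vDerive (fun s => F x s) y).

Definition gauss_map (g : R -> vec3) (x y : R) : vec3 :=
  normalize (vsub (g y) (g x)).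

(* Every ordered pair of distinct points of R/Z has exactly one representative
   (x,y) with 0 <= x < 1 and x < y < x + 1.  The value of the integrand on the
   diagonal, i.e. at y = x and y = x + 1, does not affect RInt. *)
Definition int_C2 (f : R -> R -> R) : R :=
  RInt (fun x => RInt (fun y => f x y) x (x + 1)) 0 1.

Definition eta (g : R -> vec3) : R :=
  / (4 * PI) * int_C2 (pullback_area (gauss_map g)).

(* The extended Gauss map on the cylinder of pairs (x,theta), 0 <= theta <= PI:
   for fixed x, the half great circle from - tangent (theta = 0) through n
   (theta = PI/2) to + tangent (theta = PI). *)
Definition gauss_map_L0 (g n : R -> vec3) (x theta : R) : vec3 :=
  vadd (vscale (- cos theta) (tangent g x)) (vscale (sin theta) (n x)).

Definition int_L0 (f : R -> R -> R) : R :=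
  RInt (fun x => RInt (fun theta => f x theta) 0 PI) 0 1.

(* The normalisation is 1/(4 PI), as in eta and as the total area of S^2, so
   that one full turn of n about the tangent, which sweeps the sphere once,
   counts for 1.  The constant 1/(2 PI) printed in the source is a misprint:
   by Calugareanu's theorem eta is the writhe Wr and tau_phi below the total
   twist Tw, with Wr + Tw invariant; the printed constant would give Wr + 2 Tw,
   which varies under isotopy, with either orientation of the cylinder. *)
Definition tau_phi (g n : R -> vec3) : R :=
  / (4 * PI) * int_L0 (pullback_area (gauss_map_L0 g n)).

(* Main.v *)
From Stdlib Require Import Reals Lra Lia Classical ClassicalEpsilon FunctionalExtensionality.
From Coquelicot Require Import Coquelicot.
(* Imported last: [c1] is then the first coordinate, and not the one of [C1_fun]. *)
Require Import Defs.
Open Scope R_scope.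

(** Why the sum is invariant: along an isotopy, the variation of [eta] and the
    variation of [tau_phi] are both the area swept on the sphere by the curve of
    unit tangents, with opposite signs.

    Write [v] for the velocity of the curve [g u] and [T] for its unit tangent.
    The pairs [(x, x + h)] with [0 < |h| <= 1/2] cover the configuration space,
    and there [g (x + h) - g x = h D(x,h)], where [D] is the average velocity on
    the arc from [x] to [x + h].  The map [D] extends smoothly over [h = 0], with
    value [v x], and it does not vanish for [|h| < 1] because the curve is an
    embedding.  So the Gauss map is [D / |D|] for [h > 0] and [- D / |D|] for
    [h < 0], and the form that [eta] integrates is the pull-back by [D], up to
    the sign of [h], of the solid angle form of [R^3] minus the origin.

    The solid angle form is closed ([solid_closed]), so by Stokes' theorem
    ([is_derive_solid_angle]) the derivative in [u] of its integral over
    [a <= h <= b] is a difference of boundary terms at [a] and [b].  With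
    [flux h], the integral of [det(D, D_u, D_x) / |D|^3] over the circle, the
    derivative of [4 PI eta] is [2 flux 0 - flux (1/2) - flux (-1/2)].  The last
    two cancel, since [D(x,-1/2) = - D(x,1/2)] on a curve of period 1
    ([flux_opposite]).  What remains is twice the integral of [det(T, T_u, T_x)].

    Integrating over the half great circles gives [4 PI tau_phi] as the integral
    of [2 det(T, n, n_x)] ([tau_twist]).  For a unit normal field,
    [d/du det(T, n, n_x) = d/dx det(T, n, n_u) - det(T, T_u, T_x)]
    ([twist_variation]), and the derivative along the circle integrates to 0.
    So the two variations cancel ([eta_plus_tau_constant]).

    An isotopy controls the curve only for parameters in [[0,1]].  Composed
    with the square of the sine it is a family of framed knots over the whole
    line, which has the given knots at [0] and [PI / 2]; the derivatives above
    then exist at every parameter. *)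

(** * Integrals depending on a parameter *)

(** Finitely many of the product neighbourhoods of the points [(p, h)] cover the
    compact segment, and the smallest of their radii serves for all [h]. *)
Lemma locally_tube {U : UniformSpace} (P : U -> R -> Prop) (a b : R) (p : U) :
  (forall h, a <= h <= b -> locally ((p, h) : U * R) (fun q => P (fst q) (snd q))) ->
  locally p (fun q => forall h, a <= h <= b -> P q h).
Proof.
  intros H.
  assert (Hd : forall h, exists d : posreal, a <= h <= b ->
            forall q : U * R, ball ((p, h) : U * R) d q -> P (fst q) (snd q)).
  { intros h. destruct (classic (a <= h <= b)) as [Hh|Hh].
    - destruct (H h Hh) as [d Hd]. exists d. intros _. exact Hd.
    - exists (mkposreal 1 Rlt_0_1). intros K. now destruct Hh. }
  set (delta := fun h => proj1_sig (constructive_indefinite_description _ (Hd h))).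
  destruct (compactness_value_1d a b delta) as [d Hcov].
  exists d. intros q Hq h Hh.
  apply NNPP. intros Hn. apply (Hcov h Hh). intros [t [Ht [H1 H2]]].
  apply Hn. unfold delta in H1, H2.
  destruct (constructive_indefinite_description _ (Hd t)) as [e He]. simpl in H1, H2.
  apply (He Ht (q, h)). split; simpl.
  - now apply ball_le with d.
  - exact H1.
Qed.

(** The tube lemma makes the integrands converge uniformly on the segment. *)
Lemma continuous_RInt_param {U : UniformSpace} (f : U -> R -> R) (a b : R) (p : U) :
  a <= b ->
  (forall h, a <= h <= b ->
     continuous (fun q : U * R => f (fst q) (snd q)) (p, h)) ->
  locally p (fun q => ex_RInt (f q) a b) ->
  continuous (fun q => RInt (f q) a b) p.
Proof.
  intros Hab Hf Hint.
  pose proof (locally_singleton _ _ Hint) as Hp.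
  apply filterlim_locally. intros eps.
  (* [b - a] may be 0. *)
  set (e := eps / (b - a + 1)).
  assert (He : 0 < e).
  { apply Rdiv_lt_0_compat; [apply eps | lra]. }
  assert (T : locally p (fun q => forall h, a <= h <= b -> Rabs (f q h - f p h) < 2 * (e / 2))).
  { apply (locally_tube (fun q h => Rabs (f q h - f p h) < 2 * (e / 2))).
    intros h Hh.
    (* Both [f q k] and [f p k] are compared with [f p h], for [k] near [h]. *)
    assert (Hpos : 0 < e / 2) by lra.
    pose proof (proj1 (filterlim_locally _ _) (Hf h Hh) (mkposreal _ Hpos)) as H1.
    assert (H2 : locally ((p, h) : U * R) (fun q => ball (f p h) (e / 2) (f p (snd q)))).
    { destruct H1 as [d Hd]. exists d. intros q [_ Hq].
      apply (Hd (p, snd q)). split; [apply ball_center | exact Hq]. }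
    generalize (filter_and _ _ H1 H2). apply filter_imp.
    intros q [K1 K2]. simpl in K1, K2.
    replace (f (fst q) (snd q) - f p (snd q))
      with ((f (fst q) (snd q) - f p h) - (f p (snd q) - f p h)) by ring.
    eapply Rle_lt_trans; [apply Rabs_triang|]. rewrite Rabs_Ropp.
    change (Rabs (f (fst q) (snd q) - f p h) < e / 2) in K1.
    change (Rabs (f p (snd q) - f p h) < e / 2) in K2. lra. }
  generalize (filter_and _ _ T Hint). apply filter_imp. intros q [K1 K2].
  change (Rabs (minus (RInt (f q) a b) (RInt (f p) a b)) < eps).
  rewrite <- (RInt_minus (V := R_CompleteNormedModule) _ _ _ _ K2 Hp).
  eapply Rle_lt_trans.
  - apply (abs_RInt_le_const _ a b e Hab).
    + now apply (ex_RInt_minus (V := R_NormedModule)).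
    + intros t Ht. left. replace e with (2 * (e / 2)) by field. now apply K1.
  - unfold e. apply Rlt_le_trans with ((b - a + 1) * (eps / (b - a + 1))).
    + apply Rmult_lt_compat_r; [exact He | lra].
    + right. field. lra.
Qed.

(** A form of differentiation under the integral sign in which the derivative of
    the integrand is given.  It is needed on a neighbourhood of the segment
    because the joint continuity at an end point is two-sided. *)
Lemma is_derive_RInt_cont (f f' : R -> R -> R) (a b u : R) :
  a <= b ->
  (forall h, a <= h <= b -> locally h (fun k => forall v, is_derive (fun w => f w k) v (f' v k))) ->
  (forall h, a <= h <= b -> continuous (fun q : R * R => f' (fst q) (snd q)) (u, h)) ->
  (forall v, ex_RInt (f v) a b) ->
  is_derive (fun v => RInt (f v) a b) u (RInt (f' u) a b).
Proof.
  intros Hab Hd Hc Hi.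
  replace (RInt (f' u) a b) with (RInt (fun t => Derive (fun v => f v t) u) a b).
  - apply is_derive_RInt_param.
    + apply filter_forall. intros v t. rewrite Rmin_left, Rmax_right by lra. intros Ht.
      exists (f' v t). exact (locally_singleton _ _ (Hd t Ht) v).
    + intros t. rewrite Rmin_left, Rmax_right by lra. intros Ht.
      apply continuity_2d_pt_filterlim.
      replace (Derive (fun z => f z t) u) with (f' u t).
      2: { symmetry. apply is_derive_unique. exact (locally_singleton _ _ (Hd t Ht) u). }
      apply filterlim_ext_loc with (2 := Hc t Ht).
      destruct (Hd t Ht) as [d K]. exists d. intros [q1 q2] [_ Hq]. simpl in *.
      symmetry. apply is_derive_unique. apply K. exact Hq.
    + apply filter_forall. intros v. apply Hi.
  - apply RInt_ext. intros t. rewrite Rmin_left, Rmax_right by lra. intros Ht.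
    apply is_derive_unique. apply (locally_singleton _ _ (Hd t ltac:(lra))).
Qed.

(** * Calculus of vector functions and the solid angle form *)

(** Indexing the coordinates lets a vector statement be the scalar one quantified
    over [axis]. *)
Inductive axis := axis1 | axis2 | axis3.
Definition coord (i : axis) : vec3 -> R :=
  match i with axis1 => c1 | axis2 => c2 | axis3 => c3 end.

Definition is_vderive (f : R -> vec3) (t : R) (d : vec3) : Prop :=
  forall i, is_derive (fun s => coord i (f s)) t (coord i d).
Definition vcontinuous {U : UniformSpace} (f : U -> vec3) (p : U) : Prop :=
  forall i, continuous (fun q => coord i (f q)) p.

Lemma vec3_eq (v w : vec3) : (forall i, coord i v = coord i w) -> v = w.
Proof.
  intros H. destruct v, w.
  generalize (H axis1) (H axis2) (H axis3); simpl; congruence.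
Qed.

Lemma is_vderive_vDerive f t d : is_vderive f t d -> vDerive f t = d.
Proof.
  intros H. apply vec3_eq. intros i. rewrite <- (is_derive_unique _ _ _ (H i)).
  now destruct i.
Qed.

Lemma is_vderive_unique f t d d' : is_vderive f t d -> is_vderive f t d' -> d = d'.
Proof.
  intros H H'. now rewrite <- (is_vderive_vDerive _ _ _ H), (is_vderive_vDerive _ _ _ H').
Qed.

Lemma is_vderive_ext f g t d : (forall s, f s = g s) -> is_vderive f t d -> is_vderive g t d.
Proof. intros E H i. apply is_derive_ext with (2 := H i). intros s. now rewrite E. Qed.

Ltac coordwise H :=
  generalize (H axis1) (H axis2) (H axis3); cbv beta delta [coord]; cbv iota; intros ? ? ?.

Ltac real_ring := lazymatch goal with |- ?a = ?b => change (@eq R a b) end; ring.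

Lemma is_derive_Rmult (f g : R -> R) t f' g' :
  is_derive f t f' -> is_derive g t g' ->
  is_derive (fun s => f s * g s) t (f' * g t + f t * g').
Proof. intros F G. apply (is_derive_mult f g); auto. exact Rmult_comm. Qed.
Lemma is_derive_Rplus (f g : R -> R) t f' g' :
  is_derive f t f' -> is_derive g t g' -> is_derive (fun s => f s + g s) t (f' + g').
Proof. apply (is_derive_plus (V := R_NormedModule)). Qed.
Lemma is_derive_Rminus (f g : R -> R) t f' g' :
  is_derive f t f' -> is_derive g t g' -> is_derive (fun s => f s - g s) t (f' - g').
Proof. apply (is_derive_minus (V := R_NormedModule)). Qed.
Lemma is_derive_Rdiv (f g : R -> R) t f' g' :
  is_derive f t f' -> is_derive g t g' -> g t <> 0 ->
  is_derive (fun s => f s / g s) t ((f' * g t - f t * g') / g t ^ 2).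
Proof. intros F G N. exact (is_derive_div f g t f' g' F G N). Qed.

Ltac derive_step :=
  lazymatch goal with
  | |- is_derive (fun s => @?f s + @?g s) _ _ => apply (is_derive_Rplus f g); derive_step
  | |- is_derive (fun s => @?f s - @?g s) _ _ => apply (is_derive_Rminus f g); derive_step
  | |- is_derive (fun s => @?f s * @?g s) _ _ => apply (is_derive_Rmult f g); derive_step
  | H : is_derive ?f _ _ |- is_derive ?f _ _ => exact H
  end.
Ltac derive_terms := evar_last; [ derive_step | ].

Lemma is_derive_det3 f g h t f' g' h' :
  is_vderive f t f' -> is_vderive g t g' -> is_vderive h t h' ->
  is_derive (fun s => det3 (f s) (g s) (h s)) t
    (det3 f' (g t) (h t) + det3 (f t) g' (h t) + det3 (f t) (g t) h').
Proof.
  intros F G H. coordwise F. coordwise G. coordwise H. unfold det3.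
  derive_terms. ring.
Qed.

Lemma is_derive_dot f g t f' g' :
  is_vderive f t f' -> is_vderive g t g' ->
  is_derive (fun s => dot (f s) (g s)) t (dot f' (g t) + dot (f t) g').
Proof.
  intros F G. coordwise F. coordwise G. unfold dot. derive_terms. ring.
Qed.

Lemma dot_self_pos v : v <> Vec3 0 0 0 -> 0 < dot v v.
Proof.
  intros H. destruct v as [a b c]. unfold dot; simpl.
  destruct (Req_dec a 0) as [->|Ha]; [|nra].
  destruct (Req_dec b 0) as [->|Hb]; [|nra].
  destruct (Req_dec c 0) as [->|Hc]; [congruence | nra].
Qed.

Lemma norm3_pos v : v <> Vec3 0 0 0 -> 0 < norm3 v.
Proof. intros H. apply sqrt_lt_R0. now apply dot_self_pos. Qed.

Lemma norm3_sqr v : norm3 v * norm3 v = dot v v.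
Proof. apply sqrt_def. unfold dot. nra. Qed.

Lemma is_derive_norm3 f t f' :
  is_vderive f t f' -> f t <> Vec3 0 0 0 ->
  is_derive (fun s => norm3 (f s)) t (dot (f t) f' / norm3 (f t)).
Proof.
  intros F N. pose proof (is_derive_dot _ _ _ _ _ F F) as H.
  pose proof (norm3_pos _ N) as P. pose proof (dot_self_pos _ N) as Q.
  unfold norm3 in *. 
  evar_last.
  - apply (is_derive_comp sqrt (fun s => dot (f s) (f s)) t); [|exact H].
    apply is_derive_Reals. now apply derivable_pt_lim_sqrt.
  - unfold scal; simpl; unfold mult; simpl. unfold dot. simpl. field.
    apply Rgt_not_eq. exact P.
Qed.

(** The solid angle form of [R^3] minus the origin at [v], on the vectors [x, y]. *)
Definition solid (v x y : vec3) : R := det3 v x y / norm3 v ^ 3.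
(** The differential of [solid] at [(v, x, y)] in the direction [(v', x', y')]. *)
Definition solid_diff (v x y v' x' y' : vec3) : R :=
  (det3 v' x y + det3 v x' y + det3 v x y') / norm3 v ^ 3
  - 3 * dot v v' * det3 v x y / norm3 v ^ 5.

Lemma is_derive_solid f g h t f' g' h' :
  f t <> Vec3 0 0 0 ->
  is_vderive f t f' -> is_vderive g t g' -> is_vderive h t h' ->
  is_derive (fun s => solid (f s) (g s) (h s)) t (solid_diff (f t) (g t) (h t) f' g' h').
Proof.
  intros N F G H. pose proof (is_derive_det3 _ _ _ _ _ _ _ F G H) as Hd.
  pose proof (is_derive_norm3 _ _ _ F N) as Hn.
  assert (P : norm3 (f t) <> 0) by (apply Rgt_not_eq; now apply norm3_pos).
  unfold solid. evar_last.
  - apply is_derive_Rdiv; [exact Hd | | now apply pow_nonzero].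
    exact (is_derive_pow _ 3 _ _ Hn).
  - unfold solid_diff. simpl. field. exact P.
Qed.

(** The solid angle form is closed: pulled back by a map with first derivatives
    [a, b, c] and mixed second derivatives [ab, bc, ca], its exterior derivative
    is zero.  The second derivatives cancel in pairs.  The determinants leave
    [3 det(a,b,c) / |v|^3], and differentiating [|v|^-3] takes it away, by
    Cramer's rule for [v] in terms of [a, b, c]. *)
Lemma solid_closed (v a b c ab bc ca : vec3) :
  v <> Vec3 0 0 0 ->
  solid_diff v b c a ab ca + solid_diff v c a b bc ab + solid_diff v a b c ca bc = 0.
Proof.
  intros N. unfold solid_diff.
  assert (P : norm3 v <> 0) by (apply Rgt_not_eq; now apply norm3_pos).
  pose proof (norm3_sqr v) as Q.
  set (p := norm3 v) in *.
  (* A polynomial identity, in which [p] stands for the norm, with remainder a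
     multiple of [p * p - dot v v]. *)
  match goal with |- ?l = 0 => transitivity
    ((p * p - dot v v) * (3 * det3 a b c) / p ^ 5) end.
  - destruct v, a, b, c, ab, bc, ca. unfold det3, dot; simpl. field. exact P.
  - rewrite Q. field. exact P.
Qed.

Section Continuity.
Context {U : UniformSpace}.
Implicit Types (p : U).

Lemma continuous_Rmult (f g : U -> R) p :
  continuous f p -> continuous g p -> continuous (fun q => f q * g q) p.
Proof. apply (continuous_mult (K := R_AbsRing)). Qed.
Lemma continuous_Rplus (f g : U -> R) p :
  continuous f p -> continuous g p -> continuous (fun q => f q + g q) p.
Proof. apply (continuous_plus (V := R_NormedModule)). Qed.
Lemma continuous_Rminus (f g : U -> R) p :
  continuous f p -> continuous g p -> continuous (fun q => f q - g q) p.
Proof. apply (continuous_minus (V := R_NormedModule)). Qed.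
Lemma continuous_Rdiv (f g : U -> R) p :
  continuous f p -> continuous g p -> g p <> 0 -> continuous (fun q => f q / g q) p.
Proof.
  intros F G N. apply (continuous_Rmult f (fun q => / g q)); [exact F|].
  apply (continuous_comp g Rinv); [exact G|]. now apply continuous_Rinv.
Qed.
Lemma continuous_Rpow (f : U -> R) n p :
  continuous f p -> continuous (fun q => f q ^ n) p.
Proof.
  intros F. induction n as [|n IH]; simpl; [apply continuous_const|].
  now apply continuous_Rmult.
Qed.

End Continuity.

Ltac continuous_step :=
  lazymatch goal with
  | |- continuous (fun s => @?f s + @?g s) _ => apply (continuous_Rplus f g); continuous_step
  | |- continuous (fun s => @?f s - @?g s) _ => apply (continuous_Rminus f g); continuous_step
  | |- continuous (fun s => @?f s * @?g s) _ => apply (continuous_Rmult f g); continuous_step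
  | |- continuous (fun s => @?f s / @?g s) _ => apply (continuous_Rdiv f g); continuous_step
  | |- continuous (fun s => (@?f s) ^ ?n) _ => apply (continuous_Rpow f n); continuous_step
  | H : continuous ?f _ |- continuous ?f _ => exact H
  | _ => idtac
  end.

Section VectorContinuity.
Context {U : UniformSpace}.
Implicit Types (p : U).

Lemma continuous_dot (f g : U -> vec3) p :
  vcontinuous f p -> vcontinuous g p -> continuous (fun q => dot (f q) (g q)) p.
Proof.
  intros F G. coordwise F. coordwise G. unfold dot.
  continuous_step.
Qed.
Lemma continuous_det3 (f g h : U -> vec3) p :
  vcontinuous f p -> vcontinuous g p -> vcontinuous h p ->
  continuous (fun q => det3 (f q) (g q) (h q)) p.
Proof.
  intros F G H. coordwise F. coordwise G. coordwise H. unfold det3.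
  continuous_step.
Qed.
Lemma continuous_norm3 (f : U -> vec3) p :
  vcontinuous f p -> continuous (fun q => norm3 (f q)) p.
Proof.
  intros F. unfold norm3.
  apply (continuous_comp (fun q => dot (f q) (f q)) sqrt); [now apply continuous_dot|].
  apply continuous_sqrt.
Qed.
Lemma continuous_solid (f g h : U -> vec3) p :
  f p <> Vec3 0 0 0 ->
  vcontinuous f p -> vcontinuous g p -> vcontinuous h p ->
  continuous (fun q => solid (f q) (g q) (h q)) p.
Proof.
  intros N F G H. apply continuous_Rdiv.
  - now apply continuous_det3.
  - now apply continuous_Rpow, continuous_norm3.
  - apply pow_nonzero, Rgt_not_eq. now apply norm3_pos.
Qed.
Lemma continuous_solid_diff (f g h f' g' h' : U -> vec3) p :
  f p <> Vec3 0 0 0 ->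
  vcontinuous f p -> vcontinuous g p -> vcontinuous h p ->
  vcontinuous f' p -> vcontinuous g' p -> vcontinuous h' p ->
  continuous (fun q => solid_diff (f q) (g q) (h q) (f' q) (g' q) (h' q)) p.
Proof.
  intros N F G H F' G' H'. unfold solid_diff.
  assert (P : norm3 (f p) <> 0) by (apply Rgt_not_eq; now apply norm3_pos).
  continuous_step;
    lazymatch goal with
    | |- continuous (fun s => det3 (@?a s) (@?b s) (@?c s)) _ => now apply (continuous_det3 a b c)
    | |- continuous (fun s => dot (@?a s) (@?b s)) _ => now apply (continuous_dot a b)
    | |- continuous (fun s => norm3 (@?a s)) _ => now apply (continuous_norm3 a)
    | |- _ <> 0 => now apply pow_nonzero
    | |- _ => apply continuous_const
    end.
Qed.
End VectorContinuity.

(** * Families of functions with a mixed second derivative *)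

Definition continuous2 (f : R -> R -> R) : Prop :=
  forall u t, continuous (fun q : R * R => f (fst q) (snd q)) (u, t).

(** [ftu] is the derivative both of [ft] in the parameter and of [fu] in the
    variable.  Second derivatives in the parameter are left out so that the
    class is stable under a change of parameter that is only once
    continuously differentiable. *)
Record mixed_C2 (f ft fu ftu : R -> R -> R) : Prop := {
  mixed_t : forall u t, is_derive (f u) t (ft u t);
  mixed_u : forall u t, is_derive (fun v => f v t) u (fu u t);
  mixed_tu : forall u t, is_derive (fun v => ft v t) u (ftu u t);
  mixed_ut : forall u t, is_derive (fu u) t (ftu u t);
  mixed_continuous : continuous2 f;
  mixed_continuous_t : continuous2 ft;
  mixed_continuous_u : continuous2 fu;
  mixed_continuous_tu : continuous2 ftu }.

Lemma continuous2_comp {U : UniformSpace} (f : R -> R -> R) (a b : U -> R) (p : U) :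
  continuous2 f -> continuous a p -> continuous b p ->
  continuous (fun q => f (a q) (b q)) p.
Proof. intros F A B. now apply continuous_comp_2. Qed.

Lemma continuous_Rid (t : R) : continuous (fun s : R => s) t.
Proof. apply continuous_id. Qed.

Lemma smooth2_partial_t f :
  smooth2 f -> smooth2 (fun u t => Derive (f u) t).
Proof. intros F k u t. exact (proj2 (proj2 (proj2 (proj2 (F (S k) u t))))). Qed.

Lemma smooth2_partial_u f :
  smooth2 f -> smooth2 (fun u t => Derive (fun v => f v t) u).
Proof. intros F k u t. exact (proj1 (proj2 (proj2 (proj2 (F (S k) u t))))). Qed.

Lemma smooth2_continuous2 f : smooth2 f -> continuous2 f.
Proof. intros F u t. apply continuity_2d_pt_filterlim. exact (proj1 (F 0%nat u t)). Qed.

Lemma smooth2_derive_t f u t : smooth2 f -> is_derive (f u) t (Derive (f u) t).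
Proof. intros F. apply Derive_correct. exact (proj1 (proj2 (proj2 (F 1%nat u t)))). Qed.

Lemma smooth2_derive_u f u t :
  smooth2 f -> is_derive (fun v => f v t) u (Derive (fun v => f v t) u).
Proof. intros F. apply Derive_correct. exact (proj1 (proj2 (F 1%nat u t))). Qed.

(** The two mixed derivatives agree by Schwarz's theorem. *)
Lemma smooth2_mixed f :
  smooth2 f ->
  mixed_C2 f (fun u t => Derive (f u) t) (fun u t => Derive (fun v => f v t) u)
    (fun u t => Derive (fun v => Derive (f v) t) u).
Proof.
  intros F. pose proof (smooth2_partial_t f F) as Ft. pose proof (smooth2_partial_u f F) as Fu.
  split; intros.
  - now apply smooth2_derive_t.
  - now apply smooth2_derive_u.
  - exact (smooth2_derive_u _ u t Ft).
  - rewrite Schwarz.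
    + exact (smooth2_derive_t _ u t Fu).
    + exists (mkposreal 1 Rlt_0_1). intros v s _ _. repeat split.
      * eexists; now apply smooth2_derive_u.
      * eexists; now apply smooth2_derive_t.
      * eexists; exact (smooth2_derive_u _ v s Ft).
      * eexists; exact (smooth2_derive_t _ v s Fu).
    + exact (proj1 (smooth2_partial_u _ Ft 0%nat u t)).
    + exact (proj1 (smooth2_partial_t _ Fu 0%nat u t)).
  - now apply smooth2_continuous2.
  - now apply smooth2_continuous2.
  - now apply smooth2_continuous2.
  - exact (smooth2_continuous2 _ (smooth2_partial_u _ Ft)).
Qed.

Lemma mixed_reparametrize f ft fu ftu (phi dphi : R -> R) :
  (forall u, is_derive phi u (dphi u)) -> (forall u, continuous dphi u) ->
  mixed_C2 f ft fu ftu ->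
  mixed_C2 (fun u => f (phi u)) (fun u => ft (phi u))
    (fun u t => dphi u * fu (phi u) t) (fun u t => dphi u * ftu (phi u) t).
Proof.
  intros Hphi Hd [H1 H2 H3 H4 H5 H6 H7 H8].
  assert (Cphi : forall q : R * R, continuous (fun q : R * R => phi (fst q)) q).
  { intros q. apply (continuous_comp fst phi); [apply continuous_fst|].
    apply (ex_derive_continuous (K := R_AbsRing) (V := R_NormedModule)). eexists. apply Hphi. }
  assert (Cd : forall q : R * R, continuous (fun q : R * R => dphi (fst q)) q).
  { intros q. apply (continuous_comp fst dphi); [apply continuous_fst|]. apply Hd. }
  assert (C : forall g, continuous2 g -> continuous2 (fun u => g (phi u))).
  { intros g G u t.
    apply (continuous2_comp g (fun q : R * R => phi (fst q)) snd); auto. apply continuous_snd. }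
  split; intros; auto.
  - exact (is_derive_comp (fun v => f v t) phi u _ _ (H2 (phi u) t) (Hphi u)).
  - exact (is_derive_comp (fun v => ft v t) phi u _ _ (H3 (phi u) t) (Hphi u)).
  - exact (is_derive_scal _ _ _ _ (H4 (phi u) t)).
  - intros u t. apply continuous_Rmult; [apply Cd|]. now apply (C fu).
  - intros u t. apply continuous_Rmult; [apply Cd|]. now apply (C ftu).
Qed.


(** * Weighted averages over arcs *)

(** With [f] a velocity and [a = 0], this is the average velocity over the arc from
    [x] to [x + h].  Differentiating in [h] brings down a factor [s], so the
    moments are closed under all partial derivatives, and [h = 0] is an ordinary
    point for them. *)
Definition moment (a : nat) (f : R -> R -> R) (u x h : R) : R :=
  RInt (fun s => s ^ a * f u (x + s * h)) 0 1.

Lemma continuous_moment_integrand {U : UniformSpace} (a : nat) f (s v y k : U -> R) (p : U) :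
  continuous2 f -> continuous s p -> continuous v p -> continuous y p -> continuous k p ->
  continuous (fun q => s q ^ a * f (v q) (y q + s q * k q)) p.
Proof.
  intros F S V Y K. apply continuous_Rmult; [now apply continuous_Rpow|].
  apply (continuous2_comp f v (fun q => y q + s q * k q)); auto. continuous_step.
Qed.

Lemma ex_RInt_moment a f u x h : continuous2 f ->
  ex_RInt (fun s => s ^ a * f u (x + s * h)) 0 1.
Proof.
  intros F. apply (ex_RInt_continuous (V := R_CompleteNormedModule)). intros s _.
  apply (continuous_moment_integrand a f (fun s => s) (fun _ => u) (fun _ => x) (fun _ => h));
    auto using continuous_Rid; apply continuous_const.
Qed.

Lemma continuous_moment {U : UniformSpace} a f (v y k : U -> R) (p : U) :
  continuous2 f -> continuous v p -> continuous y p -> continuous k p ->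
  continuous (fun q => moment a f (v q) (y q) (k q)) p.
Proof.
  intros F V Y K. unfold moment.
  apply (continuous_RInt_param (fun q s => s ^ a * f (v q) (y q + s * k q)) 0 1 p).
  - lra.
  - intros h _.
    assert (L : forall g : U -> R, continuous g p -> continuous (fun q : U * R => g (fst q)) (p, h)).
    { intros g G. apply (continuous_comp fst g); [apply continuous_fst | exact G]. }
    apply (continuous_moment_integrand a f snd (fun q => v (fst q)) (fun q => y (fst q))
             (fun q => k (fst q))); auto. apply continuous_snd.
  - apply filter_forall. intros q. now apply ex_RInt_moment.
Qed.

Ltac moment_derivative df :=
  apply is_derive_RInt_cont with (f' := df);
  [ lra
  | intros s0 _; apply filter_forall; intros s v
  | intros s0 _;
    apply continuous_moment_integrand; auto;
    try apply continuous_fst; try apply continuous_snd; apply continuous_const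
  | intros v; now apply ex_RInt_moment ].

Lemma is_derive_moment_u a f fu u x h :
  (forall u t, is_derive (fun v => f v t) u (fu u t)) -> continuous2 f -> continuous2 fu ->
  is_derive (fun v => moment a f v x h) u (moment a fu u x h).
Proof.
  intros D F Fu. unfold moment.
  moment_derivative (fun v s => s ^ a * fu v (x + s * h)).
  exact (is_derive_scal _ _ _ _ (D v (x + s * h))).
Qed.

Lemma is_derive_moment_x a f ft u x h :
  (forall u t, is_derive (f u) t (ft u t)) -> continuous2 f -> continuous2 ft ->
  is_derive (fun y => moment a f u y h) x (moment a ft u x h).
Proof.
  intros D F Ft. unfold moment.
  moment_derivative (fun y s => s ^ a * ft u (y + s * h)).
  apply (is_derive_scal (fun y => f u (y + s * h))).
  evar_last.
  - apply (is_derive_comp (f u) (fun y => y + s * h)); [apply D|].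
    auto_derive; auto.
  - unfold scal; simpl; unfold mult; simpl. ring.
Qed.

Lemma is_derive_moment_h a f ft u x h :
  (forall u t, is_derive (f u) t (ft u t)) -> continuous2 f -> continuous2 ft ->
  is_derive (fun k => moment a f u x k) h (moment (S a) ft u x h).
Proof.
  intros D F Ft. unfold moment.
  moment_derivative (fun k s => s ^ (S a) * ft u (x + s * k)).
  evar_last.
  - apply (is_derive_scal (fun k => f u (x + s * k))).
    apply (is_derive_comp (f u) (fun k => x + s * k)); [apply D|].
    auto_derive; auto.
  - unfold scal; simpl; unfold mult; simpl. ring.
Qed.

Lemma moment_difference f ft u x h :
  (forall u t, is_derive (f u) t (ft u t)) -> continuous2 ft ->
  h * moment 0 ft u x h = f u (x + h) - f u x.
Proof.
  intros D Ft. unfold moment.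
  assert (E : is_RInt (fun s => h * (s ^ 0 * ft u (x + s * h))) 0 1
                (minus (f u (x + 1 * h)) (f u (x + 0 * h)))).
  { apply (is_RInt_derive (fun s => f u (x + s * h))).
    - intros s _. evar_last.
      + apply (is_derive_comp (f u) (fun s => x + s * h)); [apply D|]. auto_derive; auto.
      + unfold scal; simpl; unfold mult; simpl. ring.
    - intros s _. apply continuous_Rmult; [apply continuous_const|].
      apply (continuous_moment_integrand 0 ft (fun s => s) (fun _ => u) (fun _ => x) (fun _ => h));
        auto using continuous_Rid; apply continuous_const. }
  apply (is_RInt_unique (V := R_CompleteNormedModule)) in E.
  transitivity (RInt (fun s => h * (s ^ 0 * ft u (x + s * h))) 0 1).
  - symmetry. apply (RInt_scal (V := R_CompleteNormedModule)). now apply ex_RInt_moment.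
  - rewrite E. unfold minus, plus, opp; simpl. rewrite Rmult_1_l, Rmult_0_l, Rplus_0_r. ring.
Qed.

(** * Variation of the solid angle of a strip *)

(** Joint continuity in three variables, stated by composition: it is used along
    slices on which one or two of the variables are fixed. *)
Definition vcontinuous3 (F : R -> R -> R -> vec3) : Prop :=
  forall (U : UniformSpace) (v y k : U -> R) (p : U),
    continuous v p -> continuous y p -> continuous k p ->
    vcontinuous (fun q => F (v q) (y q) (k q)) p.

(** The derivatives of a map of three variables that enter the closedness of the
    pulled back solid angle form: only mixed ones at second order. *)
Record C2_map (W Wu Wx Wh Wux Wuh Wxh : R -> R -> R -> vec3) : Prop := {
  C2_W_u : forall u x h, is_vderive (fun v => W v x h) u (Wu u x h);
  C2_W_x : forall u x h, is_vderive (fun y => W u y h) x (Wx u x h);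
  C2_W_h : forall u x h, is_vderive (fun k => W u x k) h (Wh u x h);
  C2_Wx_u : forall u x h, is_vderive (fun v => Wx v x h) u (Wux u x h);
  C2_Wu_x : forall u x h, is_vderive (fun y => Wu u y h) x (Wux u x h);
  C2_Wh_u : forall u x h, is_vderive (fun v => Wh v x h) u (Wuh u x h);
  C2_Wu_h : forall u x h, is_vderive (fun k => Wu u x k) h (Wuh u x h);
  C2_Wh_x : forall u x h, is_vderive (fun y => Wh u y h) x (Wxh u x h);
  C2_Wx_h : forall u x h, is_vderive (fun k => Wx u x k) h (Wxh u x h);
  C2_cont : vcontinuous3 W;
  C2_cont_u : vcontinuous3 Wu;
  C2_cont_x : vcontinuous3 Wx;
  C2_cont_h : vcontinuous3 Wh;
  C2_cont_ux : vcontinuous3 Wux;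
  C2_cont_uh : vcontinuous3 Wuh;
  C2_cont_xh : vcontinuous3 Wxh }.

Lemma locally_between (l r h : R) : l < h < r -> locally h (fun k => l < k < r).
Proof.
  intros [H1 H2].
  exact (filter_and _ _ (open_gt l h H1) (open_lt r h H2)).
Qed.

Lemma is_vderive_period f df :
  (forall x, is_vderive f x (df x)) -> (forall x, f (x + 1) = f x) ->
  forall x, df (x + 1) = df x.
Proof.
  intros D P x. apply (is_vderive_unique f x); [|apply D].
  intros i. apply (is_derive_ext (fun y => coord i (f (y + 1)))).
  - intros y. now rewrite P.
  - evar_last.
    + apply (is_derive_comp (fun y => coord i (f y)) (fun y => y + 1)); [apply D|].
      auto_derive; auto.
    + unfold scal; simpl; unfold mult; simpl. ring.
Qed.

Lemma RInt_derive_period (f df : R -> R) :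
  (forall x, is_derive f x (df x)) -> (forall x, continuous df x) -> f 1 = f 0 ->
  RInt df 0 1 = 0.
Proof.
  intros D C P.
  assert (E : is_RInt df 0 1 (minus (f 1) (f 0))).
  { apply (is_RInt_derive f df); auto. }
  apply (is_RInt_unique (V := R_CompleteNormedModule)) in E.
  rewrite E, P. apply (minus_eq_zero (G := R_AbelianGroup)).
Qed.

Section Stokes.
Context (W Wu Wx Wh Wux Wuh Wxh : R -> R -> R -> vec3).
Context (HW : C2_map W Wu Wx Wh Wux Wuh Wxh).
Context (l r : R).
Context (W_nonzero : forall u x h, l < h < r -> W u x h <> Vec3 0 0 0).
Context (W_period : forall u x h, W u (x + 1) h = W u x h).

(* The components of the pulled back form on the [(x, h)], [(h, u)] and [(u, x)]
   planes, and the three terms of its exterior derivative. *)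
Let A u x h := solid (W u x h) (Wx u x h) (Wh u x h).
Let B u x h := solid (W u x h) (Wh u x h) (Wu u x h).
Let C u x h := solid (W u x h) (Wu u x h) (Wx u x h).
Let Au u x h := solid_diff (W u x h) (Wx u x h) (Wh u x h) (Wu u x h) (Wux u x h) (Wuh u x h).
Let Bx u x h := solid_diff (W u x h) (Wh u x h) (Wu u x h) (Wx u x h) (Wxh u x h) (Wux u x h).
Let Ch u x h := solid_diff (W u x h) (Wu u x h) (Wx u x h) (Wh u x h) (Wuh u x h) (Wxh u x h).

Lemma continuous_strip {U : UniformSpace} (F : R -> R -> R -> R) (v y k : U -> R) p :
  F = A \/ F = B \/ F = C \/ F = Au \/ F = Bx \/ F = Ch ->
  l < k p < r -> continuous v p -> continuous y p -> continuous k p ->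
  continuous (fun q => F (v q) (y q) (k q)) p.
Proof.
  destruct HW. intros [-> | [-> | [-> | [-> | [-> | ->]]]]] Hk V Y K;
    unfold A, B, C, Au, Bx, Ch;
    lazymatch goal with
    | |- continuous (fun q => solid (@?f1 q) (@?f2 q) (@?f3 q)) _ =>
        apply (continuous_solid f1 f2 f3)
    | |- continuous (fun q => solid_diff (@?f1 q) (@?f2 q) (@?f3 q) (@?f4 q) (@?f5 q) (@?f6 q)) _ =>
        apply (continuous_solid_diff f1 f2 f3 f4 f5 f6)
    end;
    auto.
Qed.

Lemma continuous_strip_h F u x h :
  F = A \/ F = B \/ F = C \/ F = Au \/ F = Bx \/ F = Ch ->
  l < h < r -> continuous (F u x) h.
Proof.
  intros HF Hh. apply (continuous_strip F (fun _ => u) (fun _ => x) (fun h => h) h HF Hh);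
    auto using continuous_Rid; apply continuous_const.
Qed.

Context (a b : R) (Hla : l < a) (Hab : a <= b) (Hbr : b < r).

Lemma ex_RInt_strip F u x :
  F = A \/ F = B \/ F = C \/ F = Au \/ F = Bx \/ F = Ch -> ex_RInt (F u x) a b.
Proof.
  intros HF. apply (ex_RInt_continuous (V := R_CompleteNormedModule)). intros h.
  rewrite Rmin_left, Rmax_right by lra. intros Hh. apply continuous_strip_h; auto. lra.
Qed.

Lemma continuous_RInt_strip {U : UniformSpace} F (v y : U -> R) p :
  F = A \/ F = B \/ F = C \/ F = Au \/ F = Bx \/ F = Ch ->
  continuous v p -> continuous y p ->
  continuous (fun q => RInt (F (v q) (y q)) a b) p.
Proof.
  intros HF V Y.
  apply (continuous_RInt_param (fun q h => F (v q) (y q) h) a b p Hab).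
  - intros h Hh.
    assert (L : forall g : U -> R, continuous g p -> continuous (fun q : U * R => g (fst q)) (p, h)).
    { intros g G. apply (continuous_comp fst g); [apply continuous_fst | exact G]. }
    apply (continuous_strip F (fun q => v (fst q)) (fun q => y (fst q)) snd); auto.
    + simpl. lra.
    + apply continuous_snd.
  - apply filter_forall. intros q. now apply ex_RInt_strip.
Qed.

(** Stokes' theorem on the strip [a <= h <= b]: by closedness the derivative of
    the integrand in [u] is minus a divergence in [(x, h)].  The [x]-part
    integrates to 0 by periodicity, and the [h]-part leaves the two edges. *)
Theorem is_derive_solid_angle u :
  is_derive (fun u => RInt (fun x => RInt (fun h => solid (W u x h) (Wx u x h) (Wh u x h)) a b) 0 1) u
    (- RInt (fun x => solid (W u x b) (Wu u x b) (Wx u x b)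
                      - solid (W u x a) (Wu u x a) (Wx u x a)) 0 1).
Proof.
  destruct HW.
  assert (I : forall u x h, l < h < r -> Au u x h + Bx u x h + Ch u x h = 0).
  { intros v x h Hh. now apply solid_closed, W_nonzero. }
  assert (DA : forall u x, is_derive (fun v => RInt (A v x) a b) u (RInt (Au u x) a b)).
  { intros v x. apply (is_derive_RInt_cont (fun v => A v x) (fun v => Au v x)); auto.
    - intros h Hh. apply filter_imp with (2 := locally_between l r h ltac:(lra)).
      intros k Hk w. unfold A, Au.
      apply (is_derive_solid (fun w => W w x k) (fun w => Wx w x k) (fun w => Wh w x k)); auto.
    - intros h Hh. apply (continuous_strip Au fst (fun _ => x) snd); auto; simpl; try lra.
      + apply continuous_fst.
      + apply continuous_const.
      + apply continuous_snd.
    - intros w. apply ex_RInt_strip; auto. }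
  assert (DB : forall u x, is_derive (fun y => RInt (B u y) a b) x (RInt (Bx u x) a b)).
  { intros v x. apply (is_derive_RInt_cont (fun y => B v y) (fun y => Bx v y)); auto.
    - intros h Hh. apply filter_imp with (2 := locally_between l r h ltac:(lra)).
      intros k Hk w. unfold B, Bx.
      apply (is_derive_solid (fun w => W v w k) (fun w => Wh v w k) (fun w => Wu v w k)); auto.
    - intros h Hh. apply (continuous_strip Bx (fun _ => v) fst snd); auto 6; simpl; try lra.
      + apply continuous_const.
      + apply continuous_fst.
      + apply continuous_snd.
    - intros w. apply ex_RInt_strip; auto. }
  assert (DC : forall u x, RInt (Ch u x) a b = C u x b - C u x a).
  { intros v x. apply (is_RInt_unique (V := R_CompleteNormedModule)).
    apply (is_RInt_derive (C v x)); intros h; rewrite Rmin_left, Rmax_right by lra; intros Hh.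
    - apply (is_derive_solid (fun k => W v x k) (fun k => Wu v x k) (fun k => Wx v x k)); auto.
      apply W_nonzero; lra.
    - apply continuous_strip_h; auto 8. lra. }
  assert (EB : RInt (fun x => RInt (Bx u x) a b) 0 1 = 0).
  { apply (RInt_derive_period (fun x => RInt (B u x) a b)); auto.
    - intros x. apply (continuous_RInt_strip Bx (fun _ => u) (fun x => x)); auto 6 using continuous_Rid.
      apply continuous_const.
    - apply RInt_ext. intros h _. unfold B.
      replace 1 with (0 + 1) by ring. rewrite W_period. f_equal.
      + apply (is_vderive_unique (fun k => W u 0 k) h); auto.
        apply (is_vderive_ext (fun k => W u (0 + 1) k)); auto.
      + apply (is_vderive_unique (fun v => W v 0 h) u); auto.
        apply (is_vderive_ext (fun v => W v (0 + 1) h)); auto. }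
  evar_last.
  - apply (is_derive_RInt_cont (fun v x => RInt (A v x) a b) (fun v x => RInt (Au v x) a b)).
    + lra.
    + intros h _. apply filter_forall. intros k v. apply DA.
    + intros h _. apply (continuous_RInt_strip Au fst snd); auto.
      * apply continuous_fst.
      * apply continuous_snd.
    + intros v. apply (ex_RInt_continuous (V := R_CompleteNormedModule)). intros x _.
      apply (continuous_RInt_strip A (fun _ => v) (fun x => x)); auto using continuous_Rid.
      apply continuous_const.
  - assert (CC : forall x h, l < h < r -> continuous (fun x => C u x h) x).
    { intros x h Hh. apply (continuous_strip C (fun _ => u) (fun x => x) (fun _ => h));
        auto using continuous_Rid; apply continuous_const. }
    assert (IC : ex_RInt (fun x => C u x b - C u x a) 0 1).
    { apply (ex_RInt_continuous (V := R_CompleteNormedModule)). intros x _.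
      apply continuous_Rminus; apply CC; lra. }
    assert (IB : ex_RInt (fun x => RInt (Bx u x) a b) 0 1).
    { apply (ex_RInt_continuous (V := R_CompleteNormedModule)). intros x _.
      apply (continuous_RInt_strip Bx (fun _ => u) (fun x => x)); auto 6 using continuous_Rid.
      apply continuous_const. }
    transitivity (RInt (fun x => opp (plus (C u x b - C u x a) (RInt (Bx u x) a b))) 0 1).
    + apply RInt_ext. intros x _. rewrite <- DC.
      rewrite <- (RInt_plus (V := R_CompleteNormedModule)); [|apply ex_RInt_strip; auto 8..].
      rewrite <- (RInt_opp (V := R_CompleteNormedModule)).
      * apply RInt_ext. intros h. rewrite Rmin_left, Rmax_right by lra. intros Hh.
        unfold opp, plus; simpl. specialize (I u x h ltac:(lra)). lra.
      * apply (ex_RInt_plus (V := R_NormedModule)); apply ex_RInt_strip; auto 8.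
    + rewrite (RInt_opp (V := R_CompleteNormedModule)).
      * rewrite (RInt_plus (V := R_CompleteNormedModule)) by assumption.
        rewrite EB. unfold opp, plus; simpl. rewrite Rplus_0_r. reflexivity.
      * now apply (ex_RInt_plus (V := R_NormedModule)).
Qed.
End Stokes.

(** * The average velocity of an arc *)

Definition vmixed_C2 (f ft fu ftu : R -> R -> vec3) : Prop :=
  forall i, mixed_C2 (fun u t => coord i (f u t)) (fun u t => coord i (ft u t))
    (fun u t => coord i (fu u t)) (fun u t => coord i (ftu u t)).

Definition vmoment (a : nat) (f : R -> R -> vec3) (u x h : R) : vec3 :=
  Vec3 (moment a (fun v t => c1 (f v t)) u x h)
       (moment a (fun v t => c2 (f v t)) u x h)
       (moment a (fun v t => c3 (f v t)) u x h).

Lemma coord_vmoment i a f u x h :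
  coord i (vmoment a f u x h) = moment a (fun v t => coord i (f v t)) u x h.
Proof. now destruct i. Qed.

Lemma coord_vsub i v w : coord i (vsub v w) = coord i v - coord i w.
Proof. now destruct i. Qed.
Lemma coord_vadd i v w : coord i (vadd v w) = coord i v + coord i w.
Proof. now destruct i. Qed.
Lemma coord_vscale i a v : coord i (vscale a v) = a * coord i v.
Proof. now destruct i. Qed.

Lemma vcontinuous3_vmoment a f :
  (forall i, continuous2 (fun u t => coord i (f u t))) -> vcontinuous3 (vmoment a f).
Proof.
  intros F U v y k p V Y K i.
  apply (continuous_ext (fun q => moment a (fun u t => coord i (f u t)) (v q) (y q) (k q))).
  - intros q. now rewrite coord_vmoment.
  - now apply continuous_moment.
Qed.

Lemma chord_C2 V Vt Vu Vtu Vtt Vttu :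
  vmixed_C2 V Vt Vu Vtu -> vmixed_C2 Vt Vtt Vtu Vttu ->
  C2_map (vmoment 0 V) (vmoment 0 Vu) (vmoment 0 Vt) (vmoment 1 Vt)
    (vmoment 0 Vtu) (vmoment 1 Vtu) (vmoment 1 Vtt).
Proof.
  intros H1 H2.
  split;
    try (intros u x h i; destruct (H1 i), (H2 i);
         rewrite coord_vmoment;
         eapply is_derive_ext; [intros; symmetry; apply coord_vmoment|]);
    try (apply vcontinuous3_vmoment; intros i; destruct (H1 i), (H2 i); assumption).
  - now apply is_derive_moment_u.
  - now apply is_derive_moment_x.
  - now apply is_derive_moment_h.
  - now apply is_derive_moment_u.
  - now apply is_derive_moment_x.
  - now apply is_derive_moment_u.
  - now apply is_derive_moment_h.
  - now apply is_derive_moment_x.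
  - now apply is_derive_moment_h.
Qed.

Lemma moment_start f u x : moment 0 f u x 0 = f u x.
Proof.
  unfold moment. rewrite (RInt_ext (V := R_CompleteNormedModule) _ (fun _ => f u x)).
  - rewrite RInt_const. unfold scal; simpl; unfold mult; simpl. ring.
  - intros s _. rewrite Rmult_0_r, Rplus_0_r. simpl. ring.
Qed.

Lemma vmoment_start f u x : vmoment 0 f u x 0 = f u x.
Proof. apply vec3_eq. intros i. now rewrite coord_vmoment, moment_start. Qed.

Lemma vmoment_difference f ft u x h :
  (forall u t, is_vderive (f u) t (ft u t)) ->
  (forall i, continuous2 (fun u t => coord i (ft u t))) ->
  vscale h (vmoment 0 ft u x h) = vsub (f u (x + h)) (f u x).
Proof.
  intros D F. apply vec3_eq. intros i.
  rewrite coord_vscale, coord_vmoment, coord_vsub.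
  apply (moment_difference (fun u t => coord i (f u t))); auto. intros v t. apply D.
Qed.

(** Differentiate [h D(x,h) = f (x + h) - f x] in [h]. *)
Lemma vmoment_difference_diff f ft ftt u x h :
  (forall u t, is_vderive (f u) t (ft u t)) ->
  (forall u t, is_vderive (ft u) t (ftt u t)) ->
  (forall i, continuous2 (fun u t => coord i (ft u t))) ->
  (forall i, continuous2 (fun u t => coord i (ftt u t))) ->
  vadd (vmoment 0 ft u x h) (vscale h (vmoment 1 ftt u x h)) = ft u (x + h).
Proof.
  intros D D' F F'.
  apply (is_vderive_unique (fun k => f u (x + k)) h); intros i.
  - apply (is_derive_ext (fun k => k * moment 0 (fun v t => coord i (ft v t)) u x k + coord i (f u x))).
    { intros k. rewrite (moment_difference (fun u t => coord i (f u t))).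
      - real_ring.
      - intros v t. apply D.
      - apply F. }
    evar_last.
    + apply is_derive_Rplus; [|apply is_derive_const].
      apply (is_derive_Rmult (fun k => k)); [apply is_derive_id|].
      apply (is_derive_moment_h 0 (fun v t => coord i (ft v t)) (fun v t => coord i (ftt v t))); auto.
      intros v t. apply D'.
    + rewrite coord_vadd, coord_vscale, !coord_vmoment. unfold one, zero; simpl. ring.
  - evar_last.
    + apply (is_derive_comp (fun t => coord i (f u t)) (fun k => x + k)); [apply D|].
      auto_derive; auto.
    + unfold scal; simpl; unfold mult; simpl. ring.
Qed.

(** If [h] is not 0, the value times [h] is a chord of an embedded curve; at
    [h = 0] it is the velocity. *)
Lemma chord_nonzero f ft u x h :
  (forall u t, is_vderive (f u) t (ft u t)) ->
  (forall i, continuous2 (fun u t => coord i (ft u t))) ->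
  (forall s t, f u s = f u t -> exists k : Z, s - t = IZR k) ->
  (forall t, ft u t <> Vec3 0 0 0) ->
  -1 < h < 1 -> vmoment 0 ft u x h <> Vec3 0 0 0.
Proof.
  intros D F Inj Reg Hh E.
  destruct (Req_dec h 0) as [->|Hn].
  - apply (Reg x). now rewrite <- (vmoment_start ft).
  - pose proof (vmoment_difference f ft u x h D F) as K. rewrite E in K.
    assert (Q : f u (x + h) = f u x).
    { apply vec3_eq. intros i. apply (f_equal (coord i)) in K.
      rewrite coord_vsub, coord_vscale in K. destruct i; simpl in *; lra. }
    destruct (Inj _ _ Q) as [k Hk].
    assert (Hk' : IZR k = h) by lra.
    assert (-1 < k < 1)%Z by (split; apply lt_IZR; simpl; lra).
    replace k with 0%Z in Hk' by lia. now apply Hn.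
Qed.

(** * The Gauss map along chords *)
Lemma is_vderive_normalize f t f' :
  is_vderive f t f' -> f t <> Vec3 0 0 0 ->
  is_vderive (fun s => normalize (f s)) t
    (vadd (vscale (/ norm3 (f t)) f') (vscale (- dot (f t) f' / norm3 (f t) ^ 3) (f t))).
Proof.
  intros F N i. pose proof (is_derive_norm3 _ _ _ F N) as Hn.
  assert (P : norm3 (f t) <> 0) by (apply Rgt_not_eq; now apply norm3_pos).
  apply (is_derive_ext (fun s => coord i (f s) / norm3 (f s))).
  { intros s. unfold normalize. rewrite coord_vscale. unfold Rdiv. real_ring. }
  evar_last.
  - apply is_derive_Rdiv; [apply F | exact Hn | exact P].
  - rewrite coord_vadd, !coord_vscale. field. exact P.
Qed.

(** Normalising changes the derivatives of [w] by multiples of [w], which the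
    determinant does not see. *)
Lemma pullback_area_normalize (w : R -> R -> vec3) x y wx wy :
  is_vderive (fun s => w s y) x wx -> is_vderive (fun s => w x s) y wy ->
  w x y <> Vec3 0 0 0 ->
  pullback_area (fun x y => normalize (w x y)) x y = solid (w x y) wx wy.
Proof.
  intros X Y N. unfold pullback_area.
  rewrite (is_vderive_vDerive _ _ _ (is_vderive_normalize _ _ _ X N)).
  rewrite (is_vderive_vDerive _ _ _ (is_vderive_normalize _ _ _ Y N)).
  assert (P : norm3 (w x y) <> 0) by (apply Rgt_not_eq; now apply norm3_pos).
  unfold solid, normalize.
  generalize (dot (w x y) wx), (dot (w x y) wy). intros p q.
  set (m := norm3 (w x y)) in *. 
  destruct (w x y), wx, wy. unfold det3, vadd, vscale; simpl. field. exact P.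
Qed.

Lemma norm3_vscale a v : norm3 (vscale a v) = Rabs a * norm3 v.
Proof.
  unfold norm3. rewrite <- sqrt_Rsqr_abs, <- sqrt_mult_alt by apply Rle_0_sqr.
  f_equal. unfold dot, vscale, Rsqr; simpl. ring.
Qed.

Lemma solid_vscale a v x y : a <> 0 -> v <> Vec3 0 0 0 ->
  solid (vscale a v) x y = sign a / a ^ 2 * solid v x y.
Proof.
  intros A N. unfold solid. rewrite norm3_vscale.
  assert (P : norm3 v <> 0) by (apply Rgt_not_eq; now apply norm3_pos).
  replace (det3 (vscale a v) x y) with (a * det3 v x y)
    by (unfold det3, vscale; simpl; ring).
  destruct (Rtotal_order a 0) as [Ha|[Ha|Ha]]; [|contradiction|].
  - rewrite sign_eq_m1, Rabs_left by lra. field. auto.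
  - rewrite sign_eq_1, Rabs_right by lra. field. auto.
Qed.

(** For a chord [h D], the partial derivatives in the two end points and those of
    [D] in [(x, h)] differ by a shear and by multiples of [D], so the
    determinants agree up to a power of [h].  The factor [h ^ 3] over [|h| ^ 3]
    leaves the sign of [h], which reflects that the chord points along [- D]
    for [h < 0]. *)
Lemma pullback_area_gauss_map g x y gx gy h D Dx Dh :
  is_vderive g x gx -> is_vderive g y gy ->
  h <> 0 -> D <> Vec3 0 0 0 ->
  vscale h D = vsub (g y) (g x) ->
  vscale h Dx = vsub gy gx ->
  vadd D (vscale h Dh) = gy ->
  pullback_area (gauss_map g) x y = sign h * solid D Dx Dh.
Proof.
  intros X Y Hh N E Ex Eh.
  assert (Nw : vsub (g y) (g x) <> Vec3 0 0 0).
  { rewrite <- E. intros K. apply N. apply vec3_eq. intros i.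
    apply (f_equal (coord i)) in K. rewrite coord_vscale in K.
    replace (coord i (Vec3 0 0 0)) with 0 in * by now destruct i.
    apply Rmult_integral in K. now destruct K. }
  change (pullback_area (fun x y => normalize (vsub (g y) (g x))) x y = sign h * solid D Dx Dh).
  rewrite (pullback_area_normalize (fun x y => vsub (g y) (g x)) x y (vscale (-1) gx) gy); auto.
  - rewrite <- E, solid_vscale by assumption.
    replace (solid D (vscale (-1) gx) gy) with (h ^ 2 * solid D Dx Dh); [field; auto|].
    assert (Egx : gx = vsub gy (vscale h Dx)).
    { rewrite Ex. apply vec3_eq. intros i. rewrite !coord_vsub. ring. }
    subst gx gy. unfold solid.
    assert (P : norm3 D <> 0) by (apply Rgt_not_eq; now apply norm3_pos).
    set (m := norm3 D) in *. destruct D, Dx, Dh.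
    unfold det3, vadd, vsub, vscale; simpl. field. exact P.
  - intros i. apply (is_derive_ext (fun s => coord i (g y) - coord i (g s))).
    { intros s. now rewrite coord_vsub. }
    evar_last.
    + apply is_derive_Rminus; [apply is_derive_const | apply X].
    + rewrite coord_vscale. unfold zero; simpl. ring.
  - intros i. apply (is_derive_ext (fun s => coord i (g s) - coord i (g x))).
    { intros s. now rewrite coord_vsub. }
    evar_last.
    + apply is_derive_Rminus; [apply Y | apply is_derive_const].
    + unfold zero; simpl. ring.
Qed.

Lemma is_RInt_translate (f : R -> R) a b c l :
  is_RInt f a b l -> is_RInt (fun y => f (y - c)) (a + c) (b + c) l.
Proof.
  intros H. apply (is_RInt_ext (fun y => scal 1 (f (1 * y + - c)))).
  - intros y _. unfold scal; simpl; unfold mult; simpl. rewrite Rmult_1_l. f_equal. ring.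
  - apply (is_RInt_comp_lin (V := R_NormedModule)).
    replace (1 * (a + c) + - c) with a by ring. now replace (1 * (b + c) + - c) with b by ring.
Qed.

(** The second half of the circle is reached backwards from [x + 1]. *)
Lemma RInt_around_circle (f phi : R -> R) (x : R) :
  (forall h, 0 < h < 1 / 2 -> f (x + h) = phi h) ->
  (forall h, - (1 / 2) < h < 0 -> f (x + 1 + h) = - phi h) ->
  ex_RInt phi 0 (1 / 2) -> ex_RInt phi (- (1 / 2)) 0 ->
  RInt f x (x + 1) = RInt phi 0 (1 / 2) - RInt phi (- (1 / 2)) 0.
Proof.
  intros E1 E2 I1 I2. apply (is_RInt_unique (V := R_CompleteNormedModule)).
  apply (is_RInt_Chasles (V := R_NormedModule) f x (x + 1 / 2) (x + 1) _ (- RInt phi (- (1 / 2)) 0)).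
  - apply (is_RInt_ext (fun y => phi (y - x))).
    + intros y. rewrite Rmin_left, Rmax_right by lra. intros Hy.
      rewrite <- E1 by lra. f_equal. ring.
    + apply (RInt_correct (V := R_CompleteNormedModule)) in I1.
      apply (is_RInt_translate _ _ _ x) in I1.
      now rewrite Rplus_0_l, Rplus_comm in I1.
  - apply (is_RInt_ext (fun y => - phi (y - (x + 1)))).
    + intros y. rewrite Rmin_left, Rmax_right by lra. intros Hy.
      rewrite <- E2 by lra. f_equal. ring.
    + apply (is_RInt_opp (V := R_NormedModule) (fun y => phi (y - (x + 1)))).
      apply (RInt_correct (V := R_CompleteNormedModule)) in I2.
      apply (is_RInt_translate _ _ _ (x + 1)) in I2.
      rewrite Rplus_0_l in I2.
      now replace (- (1 / 2) + (x + 1)) with (x + 1 / 2) in I2 by field.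
Qed.

(** * The framing cylinder and the twist *)

(** The point of the half circle and its [theta]-derivative are combinations of the
    tangent and [n] whose coefficients have determinant [-(cos^2 + sin^2)]. *)
Lemma pullback_area_half_circle g n x theta T' n' :
  is_vderive (tangent g) x T' -> is_vderive n x n' ->
  pullback_area (gauss_map_L0 g n) x theta =
  det3 (tangent g x) (n x) n' * sin theta - det3 T' (tangent g x) (n x) * cos theta.
Proof.
  intros HT Hn. unfold pullback_area.
  rewrite (is_vderive_vDerive _ _ (vadd (vscale (- cos theta) T') (vscale (sin theta) n'))).
  2: { intros i.
    apply (is_derive_ext (fun s => (- cos theta) * coord i (tangent g s) + sin theta * coord i (n s))).
    { intros s. unfold gauss_map_L0. now rewrite coord_vadd, !coord_vscale. }
    rewrite coord_vadd, !coord_vscale.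
    apply is_derive_Rplus; apply is_derive_scal; [apply HT | apply Hn]. }
  rewrite (is_vderive_vDerive _ _ (vadd (vscale (sin theta) (tangent g x)) (vscale (cos theta) (n x)))).
  2: { intros i.
    apply (is_derive_ext (fun s => (- cos s) * coord i (tangent g x) + sin s * coord i (n x))).
    { intros s. unfold gauss_map_L0. now rewrite coord_vadd, !coord_vscale. }
    rewrite coord_vadd, !coord_vscale.
    auto_derive; [auto|ring]. }
  pose proof (sin2_cos2 theta) as SC. unfold Rsqr in SC.
  unfold gauss_map_L0. generalize (tangent g x) (n x). intros T m.
  set (s := sin theta) in *. set (c := cos theta) in *.
  transitivity ((s * s + c * c) * (det3 T m n' * s - det3 T' T m * c)).
  - destruct T, m, T', n'. unfold det3, vadd, vscale; simpl. ring.
  - rewrite SC. ring.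
Qed.

Lemma RInt_half_turn p q : RInt (fun theta => p * sin theta - q * cos theta) 0 PI = 2 * p.
Proof.
  replace (2 * p) with (minus (- p * cos PI - q * sin PI) (- p * cos 0 - q * sin 0)).
  2: { unfold minus, plus, opp; simpl. rewrite cos_PI, sin_PI, cos_0, sin_0. ring. }
  apply (is_RInt_unique (V := R_CompleteNormedModule)).
  apply (is_RInt_derive (fun t => - p * cos t - q * sin t)).
  - intros t _. auto_derive; [auto|ring].
  - intros t _. apply (ex_derive_continuous (K := R_AbsRing) (V := R_NormedModule)).
    auto_derive. auto.
Qed.

(** The identity [d/du det(T, n, n_x) = d/dx det(T, n, n_u) - det(T, T_u, T_x)]
    for the tangent [T = v / |v|], written with [v].  As [v], [nu], [nx] all lie
    in the plane orthogonal to [n], [det(v, nu, nx) = 0].  Times the square of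
    the norm of [v], the other terms combine so that [nx] and [nu] enter only
    through [dot v nx] and [dot v nu].  The constraint [dot v n = 0] turns these
    into [- dot vx n] and [- dot vu n], and the product formula for two cross
    products concludes. *)
Lemma twist_variation (v vu vx n nu nx nux : vec3) :
  v <> Vec3 0 0 0 ->
  dot n n = 1 -> dot v n = 0 -> dot n nu = 0 -> dot n nx = 0 ->
  dot vu n + dot v nu = 0 -> dot vx n + dot v nx = 0 ->
  ((det3 vu n nx + det3 v nu nx + det3 v n nux) * norm3 v
     - det3 v n nx * (dot v vu / norm3 v)) / norm3 v ^ 2 =
  ((det3 vx n nu + det3 v nx nu + det3 v n nux) * norm3 v
     - det3 v n nu * (dot v vx / norm3 v)) / norm3 v ^ 2
  - solid v vu vx.
Proof.
  intros N Hnn Hvn Hu Hx Ku Kx.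
  assert (P : norm3 v <> 0) by (apply Rgt_not_eq; now apply norm3_pos).
  assert (Q := norm3_sqr v).
  (* Expanding [n] in the dual basis of [v, nu, nx]. *)
  assert (Z : det3 v nu nx = 0).
  { transitivity (det3 v nu nx * dot n n); [rewrite Hnn; ring|].
    transitivity (dot v n * det3 n nu nx + dot n nu * det3 v n nx + dot n nx * det3 v nu n).
    - unfold det3, dot; simpl; ring.
    - rewrite Hvn, Hu, Hx. ring. }
  assert (Z' : det3 v nx nu = 0).
  { rewrite <- Ropp_0, <- Z. unfold det3; simpl; ring. }
  (* [dot v v * a - dot v a * v] is the cross product of [v] with that of [a] and
     [v]; the right-hand side is the product formula for cross products. *)
  assert (cross : forall a m, dot v v * det3 a n m - dot v a * det3 v n m
                   = dot v n * det3 a v m - dot v m * det3 v n a).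
  { intros a m. unfold det3, dot; simpl; ring. }
  pose proof (cross vu nx) as Fu. pose proof (cross vx nu) as Fx.
  assert (F : det3 v n vu * dot vx n - det3 v n vx * dot vu n
              = dot v n * det3 n vu vx - dot n n * det3 v vu vx).
  { unfold det3, dot; simpl; ring. }
  rewrite Hvn in Fu, Fx, F. rewrite Hnn in F.
  replace (dot v nx) with (- dot vx n) in Fu by lra.
  replace (dot v nu) with (- dot vu n) in Fx by lra.
  rewrite Z, Z'. rewrite <- Q in Fu, Fx. unfold solid.
  set (p := norm3 v) in *.
  apply (Rmult_eq_reg_r (p ^ 3)); [|now apply pow_nonzero].
  (* After multiplication by [p ^ 3] both sides contain the combinations in [Fu]
     and [Fx]. *)
  match goal with |- ?l = ?r =>
    replace l with ((p * p * det3 vu n nx - dot v vu * det3 v n nx) + p * p * det3 v n nux) by (field; exact P);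
    replace r with ((p * p * det3 vx n nu - dot v vx * det3 v n nu) + p * p * det3 v n nux - det3 v vu vx)
      by (field; exact P)
  end.
  rewrite Fu, Fx. lra.
Qed.

Lemma is_derive_const_eq (f : R -> R) t c d :
  (forall s, f s = c) -> is_derive f t d -> d = 0.
Proof.
  intros E H. rewrite <- (is_derive_unique _ _ _ H).
  rewrite (Derive_ext f (fun _ => c)) by exact E. apply Derive_const.
Qed.


(** * One family of framed knots *)

Section Isotopy.
(* [V] is the velocity of [g] and the suffixes denote partial derivatives; the
   curves are framed knots at every parameter of the line. *)
Context (g V Vt Vu Vtu Vtt Vttu n nt nu ntu : R -> R -> vec3).
Context (Hg : forall u t, is_vderive (g u) t (V u t)).
Context (HV : vmixed_C2 V Vt Vu Vtu) (HVt : vmixed_C2 Vt Vtt Vtu Vttu).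
Context (Hn : vmixed_C2 n nt nu ntu).
Context (Hfk : forall u, framed_knot (g u) (n u)).

Let W := vmoment 0 V.
Let Wu := vmoment 0 Vu.
Let Wx := vmoment 0 Vt.
Let Wh := vmoment 1 Vt.
(** [angle] is, up to the sign of [h], the area density of the Gauss map in the
    coordinates [(x, h)], and [flux] the density of the boundary term in Stokes'
    theorem. *)
Let angle u x h := solid (W u x h) (Wx u x h) (Wh u x h).
Let flux u x h := solid (W u x h) (Wu u x h) (Wx u x h).

Lemma velocity_nonzero u t : V u t <> Vec3 0 0 0.
Proof.
  destruct (Hfk u) as [[_ [_ [_ R]]] _].
  rewrite <- (is_vderive_vDerive _ _ _ (Hg u t)). apply R.
Qed.

Lemma curve_period u t : g u (t + 1) = g u t.
Proof. apply (Hfk u). Qed.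

Lemma velocity_period u t : V u (t + 1) = V u t.
Proof. apply (is_vderive_period (g u) (V u)); [apply Hg | apply curve_period]. Qed.

Lemma velocity_continuous i : continuous2 (fun u t => coord i (V u t)).
Proof. exact (mixed_continuous _ _ _ _ (HV i)). Qed.

Lemma velocity_derive_t u t : is_vderive (V u) t (Vt u t).
Proof. intros i. exact (mixed_t _ _ _ _ (HV i) u t). Qed.
Lemma velocity_derive_u u t : is_vderive (fun v => V v t) u (Vu u t).
Proof. intros i. exact (mixed_u _ _ _ _ (HV i) u t). Qed.

Lemma isotopy_chord_C2 : C2_map W Wu Wx Wh (vmoment 0 Vtu) (vmoment 1 Vtu) (vmoment 1 Vtt).
Proof. now apply chord_C2 with Vttu. Qed.

Lemma isotopy_chord_nonzero u x h : -1 < h < 1 -> W u x h <> Vec3 0 0 0.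
Proof.
  apply chord_nonzero with g; auto using velocity_continuous, velocity_nonzero. apply (Hfk u).
Qed.

Lemma isotopy_chord_period u x h : W u (x + 1) h = W u x h.
Proof.
  apply vec3_eq. intros i. unfold W. rewrite !coord_vmoment. unfold moment.
  apply RInt_ext. intros s _. replace (x + 1 + s * h) with (x + s * h + 1) by ring.
  now rewrite velocity_period.
Qed.

Lemma eta_chord u :
  eta (g u) = / (4 * PI) *
    RInt (fun x => RInt (angle u x) 0 (1 / 2) - RInt (angle u x) (- (1 / 2)) 0) 0 1.
Proof.
  unfold eta. f_equal. unfold int_C2. apply RInt_ext. intros x _.
  (* [y'] is [x + h] up to a period: the second half of the circle is described
     by negative [h]. *)
  assert (Chord : forall y y' h, h <> 0 -> -1 < h < 1 -> y = x + h ->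
            g u y' = g u y -> V u y' = V u y ->
            pullback_area (gauss_map (g u)) x y' = sign h * angle u x h).
  { intros y y' h H0 H1 -> Eg EV.
    apply (pullback_area_gauss_map (g u) x y' (V u x) (V u y')); auto.
    - now apply isotopy_chord_nonzero.
    - rewrite Eg. apply vmoment_difference; auto. apply velocity_continuous.
    - rewrite EV. apply vmoment_difference; [apply velocity_derive_t|].
      intros i. exact (mixed_continuous_t _ _ _ _ (HV i)).
    - rewrite EV. apply (vmoment_difference_diff g V Vt); auto using velocity_derive_t, velocity_continuous.
      intros i. exact (mixed_continuous_t _ _ _ _ (HV i)). }
  apply RInt_around_circle.
  - intros h Hh. rewrite (Chord (x + h) (x + h) h); auto; try lra.
    rewrite sign_eq_1 by lra. real_ring.
  - intros h Hh. replace (x + 1 + h) with (x + h + 1) by ring.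
    rewrite (Chord (x + h) (x + h + 1) h); auto using curve_period, velocity_period; try lra.
    rewrite sign_eq_m1 by lra. real_ring.
  - apply (ex_RInt_strip _ _ _ _ _ _ _ isotopy_chord_C2 (-1) 1 isotopy_chord_nonzero); try lra. left; reflexivity.
  - apply (ex_RInt_strip _ _ _ _ _ _ _ isotopy_chord_C2 (-1) 1 isotopy_chord_nonzero); try lra. left; reflexivity.
Qed.

(** The integrand of the total twist; [spin] is the rotation speed of the framing
    about the tangent along the isotopy, and [spin_x] its derivative along the
    curve. *)
Let twist u x := det3 (V u x) (n u x) (nt u x) / norm3 (V u x).
Let spin u x := det3 (V u x) (n u x) (nu u x) / norm3 (V u x).
Let spin_x u x :=
  ((det3 (Vt u x) (n u x) (nu u x) + det3 (V u x) (nt u x) (nu u x) + det3 (V u x) (n u x) (ntu u x))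
     * norm3 (V u x)
   - det3 (V u x) (n u x) (nu u x) * (dot (V u x) (Vt u x) / norm3 (V u x))) / norm3 (V u x) ^ 2.

Lemma framing_derive_t u t : is_vderive (n u) t (nt u t).
Proof. intros i. exact (mixed_t _ _ _ _ (Hn i) u t). Qed.
Lemma framing_derive_u u t : is_vderive (fun v => n v t) u (nu u t).
Proof. intros i. exact (mixed_u _ _ _ _ (Hn i) u t). Qed.

Lemma tangent_eq u t : tangent (g u) t = normalize (V u t).
Proof. unfold tangent. now rewrite (is_vderive_vDerive _ _ _ (Hg u t)). Qed.

Lemma tau_twist u : tau_phi (g u) (n u) = / (4 * PI) * RInt (fun x => 2 * twist u x) 0 1.
Proof.
  unfold tau_phi. f_equal. unfold int_L0. apply RInt_ext. intros x _.
  pose proof (is_vderive_normalize _ _ _ (velocity_derive_t u x) (velocity_nonzero u x)) as HT.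
  apply (is_vderive_ext _ (tangent (g u))) in HT; [|intros s; now rewrite tangent_eq].
  rewrite (RInt_ext (V := R_CompleteNormedModule) _ _ _ _
             (fun theta _ => pullback_area_half_circle (g u) (n u) x theta _ _ HT (framing_derive_t u x))).
  rewrite RInt_half_turn, tangent_eq. unfold twist, normalize.
  unfold det3, vscale, Rdiv; simpl. real_ring.
Qed.

Lemma framing_unit u t : dot (n u t) (n u t) = 1.
Proof.
  rewrite <- norm3_sqr. destruct (Hfk u) as [_ [_ [_ [H _]]]]. rewrite H. ring.
Qed.

Lemma framing_normal u t : dot (V u t) (n u t) = 0.
Proof.
  destruct (Hfk u) as [_ [_ [_ [_ H]]]]. specialize (H t). rewrite tangent_eq in H.
  pose proof (norm3_pos _ (velocity_nonzero u t)) as P.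
  apply (Rmult_eq_reg_l (/ norm3 (V u t))); [|now apply Rgt_not_eq, Rinv_0_lt_compat].
  rewrite Rmult_0_r, <- H. unfold dot, normalize, vscale; simpl. ring.
Qed.

Lemma is_derive_twist u x :
  is_derive (fun v => twist v x) u (spin_x u x - flux u x 0).
Proof.
  evar_last.
  - apply is_derive_Rdiv.
    + apply (is_derive_det3 (fun v => V v x) (fun v => n v x) (fun v => nt v x)).
      * apply velocity_derive_u.
      * apply framing_derive_u.
      * intros i. exact (mixed_tu _ _ _ _ (Hn i) u x).
    + apply (is_derive_norm3 (fun v => V v x)); [apply velocity_derive_u | apply velocity_nonzero].
    + apply Rgt_not_eq, norm3_pos, velocity_nonzero.
  - unfold flux, W, Wu, Wx. rewrite !vmoment_start.
    pose proof (is_derive_const_eq _ u _ _ (fun v => framing_unit v x)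
      (is_derive_dot _ _ _ _ _ (framing_derive_u u x) (framing_derive_u u x))) as E1.
    pose proof (is_derive_const_eq _ x _ _ (fun y => framing_unit u y)
      (is_derive_dot _ _ _ _ _ (framing_derive_t u x) (framing_derive_t u x))) as E2.
    pose proof (is_derive_const_eq _ u _ _ (fun v => framing_normal v x)
      (is_derive_dot _ _ _ _ _ (velocity_derive_u u x) (framing_derive_u u x))) as E3.
    pose proof (is_derive_const_eq _ x _ _ (fun y => framing_normal u y)
      (is_derive_dot _ _ _ _ _ (velocity_derive_t u x) (framing_derive_t u x))) as E4.
    apply twist_variation; auto using velocity_nonzero, framing_unit, framing_normal;
      revert E1 E2; unfold dot; lra.
Qed.

Lemma is_derive_spin u x : is_derive (spin u) x (spin_x u x).
Proof.
  apply is_derive_Rdiv.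
  - apply (is_derive_det3 (V u) (n u) (nu u)).
    + apply velocity_derive_t.
    + apply framing_derive_t.
    + intros i. exact (mixed_ut _ _ _ _ (Hn i) u x).
  - apply (is_derive_norm3 (V u)); [apply velocity_derive_t | apply velocity_nonzero].
  - apply Rgt_not_eq, norm3_pos, velocity_nonzero.
Qed.

Lemma spin_period u : spin u 1 = spin u 0.
Proof.
  unfold spin. replace 1 with (0 + 1) by ring. rewrite velocity_period.
  assert (P : forall v, n v (0 + 1) = n v 0).
  { intros v. destruct (Hfk v) as [_ [H _]]. apply H. }
  rewrite P. do 2 f_equal.
  apply (is_vderive_unique (fun v => n v 0) u); [|apply framing_derive_u].
  apply (is_vderive_ext (fun v => n v (0 + 1))); [exact P | apply framing_derive_u].
Qed.

Lemma vcontinuous_slice {U : UniformSpace} f (v y : U -> R) p :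
  (forall i, continuous2 (fun u t => coord i (f u t))) ->
  continuous v p -> continuous y p -> vcontinuous (fun q => f (v q) (y q)) p.
Proof. intros F A B i. now apply (continuous2_comp (fun u t => coord i (f u t))). Qed.

Lemma continuous_spin_x {U : UniformSpace} (v y : U -> R) p :
  continuous v p -> continuous y p -> continuous (fun q => spin_x (v q) (y q)) p.
Proof.
  intros A B. unfold spin_x.
  assert (C : forall f, f = V \/ f = Vt \/ f = n \/ f = nt \/ f = nu \/ f = ntu ->
            vcontinuous (fun q => f (v q) (y q)) p).
  { intros f Hf. apply vcontinuous_slice; auto. intros i. destruct (HV i), (Hn i).
    destruct Hf as [-> | [-> | [-> | [-> | [-> | ->]]]]]; assumption. }
  assert (P : norm3 (V (v p) (y p)) <> 0) by apply Rgt_not_eq, norm3_pos, velocity_nonzero.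
  continuous_step;
    lazymatch goal with
    | |- continuous (fun s => det3 (@?a s) (@?b s) (@?c s)) _ => apply (continuous_det3 a b c); auto 8
    | |- continuous (fun s => dot (@?a s) (@?b s)) _ => apply (continuous_dot a b); auto 8
    | |- continuous (fun s => norm3 (@?a s)) _ => apply (continuous_norm3 a); auto
    | |- _ => auto using pow_nonzero
    end.
Qed.

Lemma continuous_twist {U : UniformSpace} (v y : U -> R) p :
  continuous v p -> continuous y p -> continuous (fun q => twist (v q) (y q)) p.
Proof.
  intros A B. apply continuous_Rdiv.
  - apply (continuous_det3 (fun q => V (v q) (y q)) (fun q => n (v q) (y q)) (fun q => nt (v q) (y q)));
      apply vcontinuous_slice; auto; intros i; destruct (HV i), (Hn i); assumption.
  - apply (continuous_norm3 (fun q => V (v q) (y q))). apply vcontinuous_slice; auto using velocity_continuous.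
  - apply Rgt_not_eq, norm3_pos, velocity_nonzero.
Qed.

Lemma continuous_flux {U : UniformSpace} (v y k : U -> R) p :
  -1 < k p < 1 -> continuous v p -> continuous y p -> continuous k p ->
  continuous (fun q => flux (v q) (y q) (k q)) p.
Proof.
  apply (continuous_strip _ _ _ _ _ _ _ isotopy_chord_C2 (-1) 1 isotopy_chord_nonzero). right; right; left; reflexivity.
Qed.

Lemma ex_RInt_flux u h : -1 < h < 1 -> ex_RInt (fun x => flux u x h) 0 1.
Proof.
  intros Hh. apply (ex_RInt_continuous (V := R_CompleteNormedModule)). intros x _.
  apply (continuous_flux (fun _ => u) (fun x => x) (fun _ => h)); auto using continuous_Rid;
    apply continuous_const.
Qed.

Lemma RInt_spin_x u : RInt (spin_x u) 0 1 = 0.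
Proof.
  apply (RInt_derive_period (spin u)).
  - apply is_derive_spin.
  - intros x. apply (continuous_spin_x (fun _ => u) (fun x => x)); [apply continuous_const | apply continuous_Rid].
  - apply spin_period.
Qed.

Lemma ex_RInt_spin_x u : ex_RInt (spin_x u) 0 1.
Proof.
  apply (ex_RInt_continuous (V := R_CompleteNormedModule)). intros x _.
  apply (continuous_spin_x (fun _ => u) (fun x => x)); [apply continuous_const | apply continuous_Rid].
Qed.

Lemma is_derive_total_twist u :
  is_derive (fun v => RInt (twist v) 0 1) u (- RInt (fun x => flux u x 0) 0 1).
Proof.
  replace (- RInt (fun x => flux u x 0) 0 1)
    with (RInt (fun x => minus (spin_x u x) (flux u x 0)) 0 1).
  2: { rewrite (RInt_minus (V := R_CompleteNormedModule)), RInt_spin_x.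
       - unfold minus, plus, opp; simpl. ring.
       - apply ex_RInt_spin_x.
       - apply ex_RInt_flux. lra. }
  apply (is_derive_RInt_cont twist (fun u x => spin_x u x - flux u x 0)).
  - lra.
  - intros h _. apply filter_forall. intros x v. apply is_derive_twist.
  - intros h _. apply continuous_Rminus.
    + apply (continuous_spin_x fst snd); [apply continuous_fst | apply continuous_snd].
    + apply (continuous_flux fst snd (fun _ => 0)); [lra | apply continuous_fst | apply continuous_snd | apply continuous_const].
  - intros v. apply (ex_RInt_continuous (V := R_CompleteNormedModule)). intros x _.
    apply (continuous_twist (fun _ => v) (fun x => x)); [apply continuous_const | apply continuous_Rid].
Qed.

(** On a curve of period 1, the points [x + 1/2] and [x - 1/2] coincide. *)
Lemma chord_opposite u x : W u x (- (1 / 2)) = vscale (-1) (W u x (1 / 2)).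
Proof.
  pose proof (vmoment_difference g V u x (1 / 2) Hg velocity_continuous) as E1.
  pose proof (vmoment_difference g V u x (- (1 / 2)) Hg velocity_continuous) as E2.
  replace (x + 1 / 2) with (x + - (1 / 2) + 1) in E1 by field. rewrite curve_period in E1.
  rewrite <- E1 in E2. fold W in E2.
  apply vec3_eq. intros i. apply (f_equal (coord i)) in E2.
  rewrite !coord_vscale in *. lra.
Qed.

Lemma is_vderive_opposite f t d :
  is_vderive f t d -> is_vderive (fun s => vscale (-1) (f s)) t (vscale (-1) d).
Proof.
  intros D i. apply (is_derive_ext (fun s => -1 * coord i (f s))).
  - intros s. now rewrite coord_vscale.
  - rewrite coord_vscale. apply is_derive_scal, D.
Qed.

(** The flux density is odd in the map, its derivatives included. *)
Lemma flux_opposite u x : flux u x (- (1 / 2)) = - flux u x (1 / 2).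
Proof.
  destruct isotopy_chord_C2.
  assert (Eu : Wu u x (- (1 / 2)) = vscale (-1) (Wu u x (1 / 2))).
  { apply (is_vderive_unique (fun v => W v x (- (1 / 2))) u); auto.
    apply (is_vderive_ext (fun v => vscale (-1) (W v x (1 / 2)))).
    - intros v. now rewrite chord_opposite.
    - now apply is_vderive_opposite. }
  assert (Ex : Wx u x (- (1 / 2)) = vscale (-1) (Wx u x (1 / 2))).
  { apply (is_vderive_unique (fun y => W u y (- (1 / 2))) x); auto.
    apply (is_vderive_ext (fun y => vscale (-1) (W u y (1 / 2)))).
    - intros y. now rewrite chord_opposite.
    - now apply is_vderive_opposite. }
  unfold flux. rewrite Eu, Ex, chord_opposite, solid_vscale; [|lra|apply isotopy_chord_nonzero; lra].
  rewrite sign_eq_m1 by lra. unfold solid, det3, vscale; simpl. field.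
  apply Rgt_not_eq, norm3_pos, isotopy_chord_nonzero. lra.
Qed.

(** The boundary terms at [h = 0] from the two sides of the diagonal add up to
    twice the flux, which is what the total twist loses. *)
Theorem eta_plus_tau_constant u v : eta (g u) + tau_phi (g u) (n u) = eta (g v) + tau_phi (g v) (n v).
Proof.
  set (M a b u := RInt (fun x => RInt (angle u x) a b) 0 1).
  assert (IM : forall a b u, -1 < a -> a <= b -> b < 1 -> ex_RInt (fun x => RInt (angle u x) a b) 0 1).
  { intros a b w Ha Hab Hb. apply (ex_RInt_continuous (V := R_CompleteNormedModule)). intros x _.
    apply (continuous_RInt_strip _ _ _ _ _ _ _ isotopy_chord_C2 (-1) 1 isotopy_chord_nonzero a b Ha Hab Hb angle
             (fun _ => w) (fun x => x)); [left; reflexivity | apply continuous_const | apply continuous_Rid]. }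
  assert (E : forall u, eta (g u) + tau_phi (g u) (n u)
     = / (4 * PI) * (M 0 (1 / 2) u - M (- (1 / 2)) 0 u + 2 * RInt (twist u) 0 1)).
  { intros w. rewrite eta_chord, tau_twist.
    assert (It : ex_RInt (twist w) 0 1).
    { apply (ex_RInt_continuous (V := R_CompleteNormedModule)). intros x _.
      apply (continuous_twist (fun _ => w) (fun x => x)); [apply continuous_const | apply continuous_Rid]. }
    pose proof (RInt_scal (V := R_CompleteNormedModule) _ _ _ 2 It) as E1.
    pose proof (RInt_minus (V := R_CompleteNormedModule) _ _ _ _
      (IM 0 (1 / 2) w ltac:(lra) ltac:(lra) ltac:(lra)) (IM (- (1 / 2)) 0 w ltac:(lra) ltac:(lra) ltac:(lra))) as E2.
    change (RInt (fun x => 2 * twist w x) 0 1 = 2 * RInt (twist w) 0 1) in E1.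
    change (RInt (fun x => RInt (angle w x) 0 (1 / 2) - RInt (angle w x) (- (1 / 2)) 0) 0 1
             = M 0 (1 / 2) w - M (- (1 / 2)) 0 w) in E2.
    rewrite E1, E2. ring. }
  assert (DM : forall a b u, -1 < a -> a <= b -> b < 1 ->
    is_derive (M a b) u (RInt (fun x => flux u x a) 0 1 - RInt (fun x => flux u x b) 0 1)).
  { intros a b w Ha Hab Hb.
    pose proof (is_derive_solid_angle _ _ _ _ _ _ _ isotopy_chord_C2 (-1) 1
                  isotopy_chord_nonzero isotopy_chord_period a b Ha Hab Hb w) as H.
    pose proof (RInt_minus (V := R_CompleteNormedModule) _ _ _ _
      (ex_RInt_flux w b ltac:(lra)) (ex_RInt_flux w a ltac:(lra))) as E1.
    replace (RInt (fun x => flux w x a) 0 1 - RInt (fun x => flux w x b) 0 1)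
      with (- RInt (fun x => flux w x b - flux w x a) 0 1); [exact H|].
    change (RInt (fun x => flux w x b - flux w x a) 0 1
            = RInt (fun x => flux w x b) 0 1 - RInt (fun x => flux w x a) 0 1) in E1.
    rewrite E1. ring. }
  assert (D0 : forall w, is_derive (fun w => eta (g w) + tau_phi (g w) (n w)) w 0).
  { intros w.
    apply (is_derive_ext (fun u => / (4 * PI) * (M 0 (1 / 2) u - M (- (1 / 2)) 0 u + 2 * RInt (twist u) 0 1))).
    { intros s. now rewrite E. }
    evar_last.
    - apply is_derive_scal, is_derive_Rplus; [apply is_derive_Rminus|].
      + apply DM; lra.
      + apply DM; lra.
      + apply is_derive_scal, is_derive_total_twist.
    - rewrite (RInt_ext (V := R_CompleteNormedModule) (fun x => flux w x (- (1 / 2))) (fun x => opp (flux w x (1 / 2)))).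
      2: { intros x _. apply flux_opposite. }
      rewrite (RInt_opp (V := R_CompleteNormedModule)) by (apply ex_RInt_flux; lra).
      unfold opp; simpl. ring. }
  assert (Const : forall a b, a < b -> eta (g a) + tau_phi (g a) (n a) = eta (g b) + tau_phi (g b) (n b)).
  { intros a b Hab. apply (eq_is_derive (fun w => eta (g w) + tau_phi (g w) (n w))); auto. }
  destruct (Rtotal_order u v) as [H|[->|H]].
  - now apply Const.
  - reflexivity.
  - symmetry. now apply Const.
Qed.
End Isotopy.


(** * Invariance under isotopy *)

Lemma eta_plus_tau_ext (g0 g1 n0 n1 : R -> vec3) :
  (forall t, g0 t = g1 t) -> (forall t, n0 t = n1 t) ->
  eta g0 + tau_phi g0 n0 = eta g1 + tau_phi g1 n1.
Proof.
  intros Eg En.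
  rewrite (functional_extensionality g0 g1 Eg).
  now rewrite (functional_extensionality n0 n1 En).
Qed.

Definition vpartial_t (f : R -> R -> vec3) (u t : R) : vec3 := vDerive (f u) t.
Definition vpartial_u (f : R -> R -> vec3) (u t : R) : vec3 := vDerive (fun v => f v t) u.

Lemma vsmooth2_coord f : vsmooth2 f <-> forall i, smooth2 (fun u t => coord i (f u t)).
Proof.
  split.
  - intros [H1 [H2 H3]] i. now destruct i.
  - intros H. exact (conj (H axis1) (conj (H axis2) (H axis3))).
Qed.

Lemma vsmooth2_partial_t f : vsmooth2 f -> vsmooth2 (vpartial_t f).
Proof.
  intros [H1 [H2 H3]].
  exact (conj (smooth2_partial_t _ H1) (conj (smooth2_partial_t _ H2) (smooth2_partial_t _ H3))).
Qed.

Lemma vsmooth2_mixed f :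
  vsmooth2 f -> vmixed_C2 f (vpartial_t f) (vpartial_u f) (vpartial_u (vpartial_t f)).
Proof.
  intros H i. pose proof (smooth2_mixed _ (proj1 (vsmooth2_coord f) H i)) as M.
  now destruct i.
Qed.

Lemma vmixed_reparametrize f ft fu ftu (phi dphi : R -> R) :
  (forall u, is_derive phi u (dphi u)) -> (forall u, continuous dphi u) ->
  vmixed_C2 f ft fu ftu ->
  vmixed_C2 (fun u => f (phi u)) (fun u => ft (phi u))
    (fun u t => vscale (dphi u) (fu (phi u) t)) (fun u t => vscale (dphi u) (ftu (phi u) t)).
Proof.
  intros D C H i. pose proof (mixed_reparametrize _ _ _ _ phi dphi D C (H i)) as M.
  now destruct i.
Qed.

Theorem theorem3p1 (g0 n0 g1 n1 : R -> vec3)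
  (K0 : framed_knot g0 n0) (K1 : framed_knot g1 n1)
  (I : framed_isotopic g0 n0 g1 n1) :
  eta g0 + tau_phi g0 n0 = eta g1 + tau_phi g1 n1.
Proof.
  destruct I as [G [N [SG [SN [HF [G0 [N0 [G1 N1]]]]]]]].
  set (phi := fun u => sin u ^ 2). set (dphi := fun u => 2 * sin u * cos u).
  assert (Dphi : forall u, is_derive phi u (dphi u)).
  { intros u. unfold phi, dphi. auto_derive; [auto|ring]. }
  assert (Cphi : forall u, continuous dphi u).
  { intros u. apply (ex_derive_continuous (K := R_AbsRing) (V := R_NormedModule)).
    unfold dphi. auto_derive. auto. }
  assert (P0 : phi 0 = 0) by (unfold phi; rewrite sin_0; ring).
  assert (P1 : phi (PI / 2) = 1) by (unfold phi; rewrite sin_PI2; ring).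
  assert (HK : forall u, framed_knot (G (phi u)) (N (phi u))).
  { intros u. apply HF. unfold phi. pose proof (SIN_bound u). nra. }
  pose proof (vsmooth2_partial_t _ SG) as S1. pose proof (vsmooth2_partial_t _ S1) as S2.
  assert (HG : forall u t, is_vderive (G (phi u)) t (vpartial_t G (phi u) t)).
  { intros u t i. exact (mixed_t _ _ _ _ (vsmooth2_mixed _ SG i) (phi u) t). }
  pose proof (vmixed_reparametrize _ _ _ _ phi dphi Dphi Cphi (vsmooth2_mixed _ S1)) as M1.
  pose proof (vmixed_reparametrize _ _ _ _ phi dphi Dphi Cphi (vsmooth2_mixed _ S2)) as M2.
  pose proof (vmixed_reparametrize _ _ _ _ phi dphi Dphi Cphi (vsmooth2_mixed _ SN)) as MN.
  pose proof (eta_plus_tau_constant _ _ _ _ _ _ _ _ _ _ _ HG M1 M2 MN HK 0 (PI / 2)) as E.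
  cbv beta in E. rewrite P0, P1 in E.
  rewrite (eta_plus_tau_ext g0 (G 0) n0 (N 0)) by (intros t; auto).
  rewrite E. now apply eta_plus_tau_ext.
Qed.
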